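(* Let $N=2$, let $0\neq q\in\mathbb{C}$, and let $\xi=\begin{pmatrix}0&\xi_1\\0&0\end{pmatrix}$, where $0\neq\xi_1\in\mathbb{C}$. Then the following hold. (i) The image of $\beta^\xi$ is the subalgebra of $\mathcal{O}(GL_q)$ generated by $x_{21}^2/\det_q$, $x_{21}x_{22}/\det_q$, $x_{22}^2/\det_q$. In particular, $\mathrm{im}(\beta^\xi)$ is a quantum homogeneous space (i.e. a right coideal subalgebra of $\mathcal{O}(GL_q)$). (ii) The kernel of $\beta^\xi$ is the right ideal of $\mathcal{O}(M_q)$ generated by $\tau_1$ and $\tau_2$. (i') $\mathrm{im}(\alpha^\xi)$ is the subalgebra of $\mathcal{O}(GL_q)$ generated by $x_{21}^2/\det_q$, $x_{21}x_{22}/\det_q$, $x_{22}^2/\det_q$. (ii') $\ker(\alpha^\xi)=\sum_{i=1}^2\mathcal{O}(M_q)\sigma_i$.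
   Context: $\mathcal{O}(M_q)$ (here for $2\times 2$ quantum matrices) is the unital associative $\mathbb{C}$-algebra generated by $x_{11},x_{12},x_{21},x_{22}$ subject to $x_{11}x_{12}=qx_{12}x_{11}$, $x_{21}x_{22}=qx_{22}x_{21}$, $x_{11}x_{21}=qx_{21}x_{11}$, $x_{12}x_{22}=qx_{22}x_{12}$, $x_{12}x_{21}=x_{21}x_{12}$, $x_{11}x_{22}-x_{22}x_{11}=(q-q^{-1})x_{12}x_{21}$. It is a bialgebra with $\Delta(x_{ij})=\sum_k x_{ik}\otimes x_{kj}$, $\varepsilon(x_{ij})=\delta_{ij}$. The quantum determinant $\det_q=x_{11}x_{22}-qx_{12}x_{21}$ is central, and $\mathcal{O}(GL_q)=\mathcal{O}(M_q)[\det_q^{-1}]$ is a Hopf algebra with comultiplication $\Delta$ and antipode $S$ given by $S(x_{11})=x_{22}/\det_q$, $S(x_{22})=x_{11}/\det_q$, $S(x_{12})=-q^{-1}x_{12}/\det_q$, $S(x_{21})=-qx_{21}/\det_q$. In Sweedler notation, define the right coactions $\beta,\alpha:\mathcal{O}(M_q)\to\mathcal{O}(M_q)\otimes\mathcal{O}(GL_q)$ by $\beta(h)=\sum h_2\otimes S(h_1)h_3$ and $\alpha(h)=\sum h_2\otimes h_3S(h_1)$. The entries of the matrix $\xi$ of the claim satisfy the defining relations of $\mathcal{O}(M_q)$, so there is an algebra homomorphism $\mathrm{ev}_\xi:\mathcal{O}(M_q)\to\mathbb{C}$, $x_{ij}\mapsto\xi_{ij}$ (where $\xi_{ij}$ is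 the $(i,j)$ entry of $\xi$). The co-orbit maps are the linear maps $\beta^\xi=(\mathrm{ev}_\xi\otimes\mathrm{id})\circ\beta$ and $\alpha^\xi=(\mathrm{ev}_\xi\otimes\mathrm{id})\circ\alpha$ from $\mathcal{O}(M_q)$ to $\mathcal{O}(GL_q)$. Set $\tau_1=q^{-2}x_{11}+q^{-4}x_{22}$, $\tau_2=q^{-6}\det_q$, $\sigma_1=x_{11}+x_{22}$, $\sigma_2=\det_q$ (the scalar factor in $\tau_2$ is immaterial). Subalgebras are unital. A right coideal subalgebra of $\mathcal{O}(GL_q)$ is a subalgebra $B$ with $\Delta(B)\subseteq B\otimes\mathcal{O}(GL_q)$. *)

(* Defs.v *)
From HB Require Import structures.
From mathcomp Require Import all_boot all_algebra.
From mathcomp Require Import boolp classical_sets reals.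
From mathcomp Require Import complex ring.

Set Implicit Arguments.
Unset Strict Implicit.
Unset Printing Implicit Defensive.

Import GRing.Theory.
Local Open Scope ring_scope.
Local Open Scope quotient_scope.
Local Open Scope classical_set_scope.

Reserved Notation "U ⊗ V" (at level 40, left associativity).
Reserved Notation "u ⊠ v" (at level 40, left associativity).

Declare Scope nc_scope.
Delimit Scope nc_scope with nc.

(* Noncommutative polynomial expressions in the generators X; the scalar
   multiple c *: t is written c%:T * t. *)
Inductive term (K X : Type) : Type :=
| tcst of K
| tgen of X
| tadd of term K X & term K X
| tmul of term K X & term K X.

Arguments tcst {K X}.
Arguments tgen {K X}.

Notation "c %:T" := (tcst c) : nc_scope.
Notation "s + t" := (tadd s t) : nc_scope.
Notation "s * t" := (tmul s t) : nc_scope.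

HB.instance Definition _ (K X : Type) := gen_eqMixin (term K X).
HB.instance Definition _ (K X : Type) := gen_choiceMixin (term K X).

Section Congruence.
Variables (K : fieldType) (X : Type).
Variable rel : term K X -> term K X -> Prop.
Local Open Scope nc_scope.

(* The least congruence containing rel whose quotient is a K-algebra. *)
Inductive tcong : term K X -> term K X -> Prop :=
| tcong_rel s t : rel s t -> tcong s t
| tcong_refl t : tcong t t
| tcong_sym s t : tcong s t -> tcong t s
| tcong_trans t s u : tcong s t -> tcong t u -> tcong s u
| tcong_add s s' t t' : tcong s s' -> tcong t t' -> tcong (s + t) (s' + t')
| tcong_mul s s' t t' : tcong s s' -> tcong t t' -> tcong (s * t) (s' * t')
| tcong_addA s t u : tcong (s + (t + u)) ((s + t) + u)
| tcong_addC s t : tcong (s + t) (t + s)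
| tcong_add0 t : tcong (0%R%:T + t) t
| tcong_addN t : tcong ((- 1)%R%:T * t + t) 0%R%:T
| tcong_mulA s t u : tcong (s * (t * u)) ((s * t) * u)
| tcong_mul1l t : tcong (1%R%:T * t) t
| tcong_mul1r t : tcong (t * 1%R%:T) t
| tcong_mulDl s t u : tcong ((s + t) * u) (s * u + t * u)
| tcong_mulDr s t u : tcong (s * (t + u)) (s * t + s * u)
| tcong_cstD a b : tcong (a + b)%R%:T (a%:T + b%:T)
| tcong_cstM a b : tcong (a * b)%R%:T (a%:T * b%:T)
| tcong_cstC a t : tcong (a%:T * t) (t * a%:T).

End Congruence.

Section Eval.
Variables (K : fieldType) (X : Type) (B : algType K) (g : X -> B).

Fixpoint teval (t : term K X) : B :=
  match t with
  | tcst c => c%:A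
  | tgen x => g x
  | tadd s t => teval s + teval t
  | tmul s t => teval s * teval t
  end.

Variable rel : term K X -> term K X -> Prop.
Definition respects := forall s t, rel s t -> teval s = teval t.

Lemma teval_cong : respects -> forall s t, tcong rel s t -> teval s = teval t.
Proof.
move=> hg s t; elim=> {s t} //=.
- by move=> t s u _ -> _ ->.
- by move=> s s' t t' _ -> _ ->.
- by move=> s s' t t' _ -> _ ->.
- by move=> s t u; rewrite addrA.
- by move=> s t; rewrite addrC.
- by move=> t; rewrite scale0r add0r.
- by move=> t; rewrite scaleN1r mulN1r addNr scale0r.
- by move=> s t u; rewrite mulrA.
- by move=> t; rewrite scale1r mul1r.
- by move=> t; rewrite scale1r mulr1.
- by move=> s t u; rewrite mulrDl.
- by move=> s t u; rewrite mulrDr.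
- by move=> a b; rewrite scalerDl.
- by move=> a b; rewrite -scalerAl mul1r scalerA.
- by move=> a t; rewrite -scalerAl -scalerAr mul1r mulr1.
Qed.

End Eval.

(* MathComp algebras are nonzero, hence the last field. *)
Record presentation (K : fieldType) := Presentation {
  pgen : Type;
  prel : term K pgen -> term K pgen -> Prop;
  pnontrivial : ~ tcong prel (tcst 1) (tcst 0) }.

Section Presented.
Variables (K : fieldType) (P : presentation K).

Definition pequiv (s t : term K (pgen P)) : bool := `[< tcong (@prel K P) s t >].

Lemma pequiv_equiv : equiv_class_of pequiv.
Proof.
split=> [t|s t|t s u]; first exact/asboolP/tcong_refl.
  by apply/asboolP/asboolP; apply: tcong_sym.
by move=> /asboolP st /asboolP tu; apply/asboolP/(tcong_trans st tu).
Qed.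
Canonical pequiv_equiv_rel := EquivRelPack pequiv_equiv.

Definition presented := {eq_quot pequiv}.
HB.instance Definition _ := Choice.on presented.

Definition pcls (t : term K (pgen P)) : presented := \pi t.
Definition prepr (a : presented) : term K (pgen P) := repr a.
Definition pX (x : pgen P) : presented := pcls (tgen x).

Lemma preprK a : pcls (prepr a) = a. Proof. exact: reprK. Qed.

Lemma pclsP s t : pcls s = pcls t <-> tcong (@prel K P) s t.
Proof.
by split=> [/eqP|st]; [rewrite eqmodE => /asboolP | apply/eqP; rewrite eqmodE; apply/asboolP].
Qed.

Lemma pcls_repr t : tcong (@prel K P) (prepr (pcls t)) t.
Proof. by apply/pclsP; rewrite preprK. Qed.

Definition padd (a b : presented) := pcls (tadd (prepr a) (prepr b)).
Definition pmul (a b : presented) := pcls (tmul (prepr a) (prepr b)).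
Definition pcst (c : K) : presented := pcls (tcst c).
Definition popp (a : presented) := pmul (pcst (- 1)) a.
Definition pscale (c : K) (a : presented) := pmul (pcst c) a.

Lemma paddE s t : padd (pcls s) (pcls t) = pcls (tadd s t).
Proof. by apply/pclsP/tcong_add; apply: pcls_repr. Qed.
Lemma pmulE s t : pmul (pcls s) (pcls t) = pcls (tmul s t).
Proof. by apply/pclsP/tcong_mul; apply: pcls_repr. Qed.

Let pE := (paddE, pmulE).

Lemma paddA : associative padd.
Proof.
by move=> a b c; rewrite -[a]preprK -[b]preprK -[c]preprK !pE; apply/pclsP/tcong_addA.
Qed.
Lemma paddC : commutative padd.
Proof. by move=> a b; rewrite -[a]preprK -[b]preprK !pE; apply/pclsP/tcong_addC. Qed.
Lemma padd0 : left_id (pcst 0) padd.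
Proof. by move=> a; rewrite -[a]preprK !pE; apply/pclsP/tcong_add0. Qed.
Lemma paddN : left_inverse (pcst 0) popp padd.
Proof. by move=> a; rewrite -[a]preprK /popp pmulE paddE; apply/pclsP/tcong_addN. Qed.

HB.instance Definition _ := GRing.isZmodule.Build presented paddA paddC padd0 paddN.

Lemma pmulA : associative pmul.
Proof.
by move=> a b c; rewrite -[a]preprK -[b]preprK -[c]preprK !pE; apply/pclsP/tcong_mulA.
Qed.
Lemma pmul1l : left_id (pcst 1) pmul.
Proof. by move=> a; rewrite -[a]preprK !pE; apply/pclsP/tcong_mul1l. Qed.
Lemma pmul1r : right_id (pcst 1) pmul.
Proof. by move=> a; rewrite -[a]preprK !pE; apply/pclsP/tcong_mul1r. Qed.
Lemma pmulDl : left_distributive pmul padd.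
Proof.
by move=> a b c; rewrite -[a]preprK -[b]preprK -[c]preprK !pE; apply/pclsP/tcong_mulDl.
Qed.
Lemma pmulDr : right_distributive pmul padd.
Proof.
by move=> a b c; rewrite -[a]preprK -[b]preprK -[c]preprK !pE; apply/pclsP/tcong_mulDr.
Qed.
Lemma pone_neq0 : pcst 1 != 0.
Proof. by apply/eqP => /pclsP; apply: pnontrivial. Qed.

HB.instance Definition _ := GRing.Zmodule_isNzRing.Build presented
  pmulA pmul1l pmul1r pmulDl pmulDr pone_neq0.

Lemma pcstD a b : pcst (a + b) = pcst a + pcst b.
Proof. by rewrite [RHS]paddE; apply/pclsP/tcong_cstD. Qed.
Lemma pcstM a b : pcst (a * b) = pcst a * pcst b.
Proof. by rewrite [RHS]pmulE; apply/pclsP/tcong_cstM. Qed.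
Lemma pcstC a (u : presented) : pcst a * u = u * pcst a.
Proof. by rewrite -[u]preprK [LHS]pmulE [RHS]pmulE; apply/pclsP/tcong_cstC. Qed.

Lemma pscaleA a b u : pscale a (pscale b u) = pscale (a * b) u.
Proof. by rewrite /pscale pcstM; apply: mulrA. Qed.
Lemma pscale1 : left_id 1 pscale.
Proof. by move=> u; apply: mul1r. Qed.
Lemma pscaleDr : right_distributive pscale +%R.
Proof. by move=> a u v; apply: mulrDr. Qed.
Lemma pscaleDl u : {morph pscale^~ u : a b / a + b}.
Proof. by move=> a b; rewrite /pscale pcstD; apply: mulrDl. Qed.

HB.instance Definition _ := GRing.Zmodule_isLmodule.Build K presented
  pscaleA pscale1 pscaleDr pscaleDl.

Lemma pscaleAl a (u v : presented) : a *: (u * v) = (a *: u) * v.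
Proof. exact: mulrA. Qed.
HB.instance Definition _ := GRing.Lmodule_isLalgebra.Build K presented pscaleAl.

Lemma pscaleAr a (u v : presented) : a *: (u * v) = u * (a *: v).
Proof.
change (pcst a * (u * v) = u * (pcst a * v)).
by rewrite !mulrA pcstC.
Qed.
HB.instance Definition _ := GRing.Lalgebra_isAlgebra.Build K presented pscaleAr.

Lemma pcstE c : pcst c = c%:A.
Proof. by rewrite -[pcst c]mulr1. Qed.

Lemma teval_pX t : teval pX t = pcls t.
Proof.
elim: t => [c|x|s IHs t IHt|s IHs t IHt] //=; first by rewrite -pcstE.
  by rewrite IHs IHt [LHS]paddE.
by rewrite IHs IHt [LHS]pmulE.
Qed.

Lemma pX_respects : respects pX (@prel K P).
Proof. by move=> s t st; rewrite !teval_pX; apply/pclsP/tcong_rel. Qed.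

Lemma presented_ext (B : algType K) (f h : {lrmorphism presented -> B}) :
  (forall x, f (pX x) = h (pX x)) -> f =1 h.
Proof.
move=> fh a; rewrite -[a]preprK; elim: (prepr a) => [c|x|s IHs t IHt|s IHs t IHt].
- by rewrite -[pcls _]/(pcst c) pcstE !linearZ /= !rmorph1.
- exact: fh.
- by rewrite -[pcls _]paddE !rmorphD /= IHs IHt.
- by rewrite -[pcls _]pmulE !rmorphM /= IHs IHt.
Qed.

Section Lift.
Variables (B : algType K) (g : pgen P -> B) (hg : respects g (@prel K P)).

Definition plift of respects g (@prel K P) :=
  fun a : presented => teval g (prepr a).

Lemma plift_cls t : plift hg (pcls t) = teval g t.
Proof. exact: (teval_cong hg (pcls_repr t)). Qed.

Lemma plift_linear : linear (plift hg).
Proof.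
move=> c u v; rewrite -[u]preprK -[v]preprK.
rewrite -[c *: _]/(pmul (pcst c) _) pmulE -[(_ + _)%R]/(padd _ _) paddE.
by rewrite !plift_cls /= -scalerAl mul1r.
Qed.
HB.instance Definition _ :=
  GRing.isLinear.Build K presented B _ (plift hg) plift_linear.

Lemma plift_monoid : monoid_morphism (plift hg).
Proof.
split=> [|u v]; first by rewrite -[1]/(pcst 1) plift_cls /= scale1r.
by rewrite -[u]preprK -[v]preprK -[(_ * _)%R]/(pmul _ _) pmulE !plift_cls.
Qed.
HB.instance Definition _ :=
  GRing.isMonoidMorphism.Build presented B (plift hg) plift_monoid.

Lemma plift_pX x : plift hg (pX x) = g x.
Proof. exact: plift_cls. Qed.

End Lift.
End Presented.

Inductive tterm (K U V : Type) : Type :=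
| ttzero
| ttpure of U & V
| ttadd of tterm K U V & tterm K U V
| ttscale of K & tterm K U V.

Arguments ttzero {K U V}.
Arguments ttpure {K U V}.

HB.instance Definition _ (K U V : Type) := gen_eqMixin (tterm K U V).
HB.instance Definition _ (K U V : Type) := gen_choiceMixin (tterm K U V).

Section Tensor.
Variables (K : fieldType) (U V : lmodType K).

(* The least congruence whose quotient is a K-module in which pure terms are
   bilinear. *)
Inductive ttcong : tterm K U V -> tterm K U V -> Prop :=
| ttcong_refl t : ttcong t t
| ttcong_sym s t : ttcong s t -> ttcong t s
| ttcong_trans t s u : ttcong s t -> ttcong t u -> ttcong s u
| ttcong_add s s' t t' :
    ttcong s s' -> ttcong t t' -> ttcong (ttadd s t) (ttadd s' t')
| ttcong_scale a t t' : ttcong t t' -> ttcong (ttscale a t) (ttscale a t')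
| ttcong_addA s t u : ttcong (ttadd s (ttadd t u)) (ttadd (ttadd s t) u)
| ttcong_addC s t : ttcong (ttadd s t) (ttadd t s)
| ttcong_add0 t : ttcong (ttadd ttzero t) t
| ttcong_addN t : ttcong (ttadd (ttscale (- 1) t) t) ttzero
| ttcong_scaleA a b t : ttcong (ttscale a (ttscale b t)) (ttscale (a * b) t)
| ttcong_scale1 t : ttcong (ttscale 1 t) t
| ttcong_scaleDr a s t :
    ttcong (ttscale a (ttadd s t)) (ttadd (ttscale a s) (ttscale a t))
| ttcong_scaleDl a b t :
    ttcong (ttscale (a + b) t) (ttadd (ttscale a t) (ttscale b t))
| ttcong_pureDl u u' v :
    ttcong (ttpure (u + u') v) (ttadd (ttpure u v) (ttpure u' v))
| ttcong_pureDr u v v' :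
    ttcong (ttpure u (v + v')) (ttadd (ttpure u v) (ttpure u v'))
| ttcong_pureZl a u v : ttcong (ttpure (a *: u) v) (ttscale a (ttpure u v))
| ttcong_pureZr a u v : ttcong (ttpure u (a *: v)) (ttscale a (ttpure u v)).

Definition ttequiv (s t : tterm K U V) : bool := `[< ttcong s t >].

Lemma ttequiv_equiv : equiv_class_of ttequiv.
Proof.
split=> [t|s t|t s u]; first exact/asboolP/ttcong_refl.
  by apply/asboolP/asboolP; apply: ttcong_sym.
by move=> /asboolP st /asboolP tu; apply/asboolP/(ttcong_trans st tu).
Qed.
Canonical ttequiv_equiv_rel := EquivRelPack ttequiv_equiv.

Definition tens := {eq_quot ttequiv}.
HB.instance Definition _ := Choice.on tens.

Definition tcls (t : tterm K U V) : tens := \pi t.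
Definition trepr (a : tens) : tterm K U V := repr a.
Definition tpure (u : U) (v : V) : tens := tcls (ttpure u v).

Lemma treprK a : tcls (trepr a) = a. Proof. exact: reprK. Qed.

Lemma tclsP s t : tcls s = tcls t <-> ttcong s t.
Proof.
by split=> [/eqP|st]; [rewrite eqmodE => /asboolP | apply/eqP; rewrite eqmodE; apply/asboolP].
Qed.

Lemma tcls_repr t : ttcong (trepr (tcls t)) t.
Proof. by apply/tclsP; rewrite treprK. Qed.

Definition tens_add (a b : tens) := tcls (ttadd (trepr a) (trepr b)).
Definition tens_scale (c : K) (a : tens) := tcls (ttscale c (trepr a)).

Lemma tens_addE s t : tens_add (tcls s) (tcls t) = tcls (ttadd s t).
Proof. by apply/tclsP/ttcong_add; apply: tcls_repr. Qed.
Lemma tens_scaleE c t : tens_scale c (tcls t) = tcls (ttscale c t).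
Proof. by apply/tclsP/ttcong_scale; apply: tcls_repr. Qed.

Lemma tens_addA : associative tens_add.
Proof.
by move=> a b c; rewrite -[a]treprK -[b]treprK -[c]treprK !tens_addE; apply/tclsP/ttcong_addA.
Qed.
Lemma tens_addC : commutative tens_add.
Proof.
by move=> a b; rewrite -[a]treprK -[b]treprK !tens_addE; apply/tclsP/ttcong_addC.
Qed.
Lemma tens_add0 : left_id (tcls ttzero) tens_add.
Proof. by move=> a; rewrite -[a]treprK !tens_addE; apply/tclsP/ttcong_add0. Qed.
Lemma tens_addN : left_inverse (tcls ttzero) (tens_scale (- 1)) tens_add.
Proof.
by move=> a; rewrite -[a]treprK tens_scaleE tens_addE; apply/tclsP/ttcong_addN.
Qed.

HB.instance Definition _ :=
  GRing.isZmodule.Build tens tens_addA tens_addC tens_add0 tens_addN.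

Lemma tens_scaleA a b u : tens_scale a (tens_scale b u) = tens_scale (a * b) u.
Proof. by rewrite -[u]treprK !tens_scaleE; apply/tclsP/ttcong_scaleA. Qed.
Lemma tens_scale1 : left_id 1 tens_scale.
Proof. by move=> u; rewrite -[u]treprK !tens_scaleE; apply/tclsP/ttcong_scale1. Qed.
Lemma tens_scaleDr : right_distributive tens_scale +%R.
Proof.
move=> a u v; rewrite -[u]treprK -[v]treprK -![(_ + _)%R]/(tens_add _ _).
rewrite tens_addE; rewrite !tens_scaleE tens_addE.
exact/tclsP/ttcong_scaleDr.
Qed.
Lemma tens_scaleDl u : {morph tens_scale^~ u : a b / a + b}.
Proof.
move=> a b; rewrite -[u]treprK -[RHS]/(tens_add _ _).
by rewrite !tens_scaleE tens_addE; apply/tclsP/ttcong_scaleDl.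
Qed.

HB.instance Definition _ := GRing.Zmodule_isLmodule.Build K tens
  tens_scaleA tens_scale1 tens_scaleDr tens_scaleDl.

Lemma tclsD s t : tcls (ttadd s t) = tcls s + tcls t.
Proof. by rewrite [RHS]tens_addE. Qed.
Lemma tclsZ a t : tcls (ttscale a t) = a *: tcls t.
Proof. by rewrite [RHS]tens_scaleE. Qed.

Lemma tpure_linearl v : linear (tpure^~ v).
Proof.
move=> a u u'; rewrite -tclsZ -tclsD; apply/tclsP.
exact: ttcong_trans (ttcong_pureDl _ _ _)
  (ttcong_add (ttcong_pureZl _ _ _) (ttcong_refl _)).
Qed.
Lemma tpure_linearr u : linear (tpure u).
Proof.
move=> a v v'; rewrite -tclsZ -tclsD; apply/tclsP.
exact: ttcong_trans (ttcong_pureDr _ _ _)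
  (ttcong_add (ttcong_pureZr _ _ _) (ttcong_refl _)).
Qed.

Lemma tens_ext (W : lmodType K) (f h : {linear tens -> W}) :
  (forall u v, f (tpure u v) = h (tpure u v)) -> f =1 h.
Proof.
move=> fh a; rewrite -[a]treprK; elim: (trepr a) => [|u v|s IHs t IHt|c t IHt].
- by rewrite -[tcls _]/(0 : tens) !linear0.
- exact: fh.
- by rewrite tclsD !linearD /= IHs IHt.
- by rewrite tclsZ !linearZ /= IHt.
Qed.

Section Lift.
Variables (W : lmodType K) (f : U -> V -> W).
Hypotheses (fl : forall v, linear (f^~ v)) (fr : forall u, linear (f u)).

Fixpoint ttlift (t : tterm K U V) : W :=
  match t with
  | ttzero => 0
  | ttpure u v => f u v
  | ttadd s t => ttlift s + ttlift t
  | ttscale a t => a *: ttlift t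
  end.

Lemma ttlift_cong s t : ttcong s t -> ttlift s = ttlift t.
Proof.
have lin (X : lmodType K) (k : X -> W) : linear k ->
    (forall x y, k (x + y) = k x + k y) /\ (forall a x, k (a *: x) = a *: k x).
  move=> kl; have kD x y : k (x + y) = k x + k y.
    by have := kl 1 x y; rewrite !scale1r.
  have k0 : k 0 = 0 by apply: (addIr (k 0)); rewrite -kD !add0r.
  by split=> // a x; have := kl a x 0; rewrite k0 !addr0.
elim=> {s t} //=.
- by move=> t s u _ -> _ ->.
- by move=> s s' t t' _ -> _ ->.
- by move=> a t t' _ ->.
- by move=> s t u; rewrite addrA.
- by move=> s t; rewrite addrC.
- by move=> t; rewrite add0r.
- by move=> t; rewrite scaleN1r addNr.
- by move=> a b t; rewrite scalerA.
- by move=> t; rewrite scale1r.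
- by move=> a s t; rewrite scalerDr.
- by move=> a b t; rewrite scalerDl.
- by move=> u u' v; rewrite (lin _ _ (fl v)).1.
- by move=> u v v'; rewrite (lin _ _ (fr u)).1.
- by move=> a u v; rewrite (lin _ _ (fl v)).2.
- by move=> a u v; rewrite (lin _ _ (fr u)).2.
Qed.

Definition tlift of (forall v, linear (f^~ v)) & (forall u, linear (f u)) :=
  fun a : tens => ttlift (trepr a).

Lemma tlift_cls t : tlift fl fr (tcls t) = ttlift t.
Proof. exact: ttlift_cong (tcls_repr t). Qed.

Lemma tlift_linear : linear (tlift fl fr).
Proof.
move=> a s t; rewrite -[s]treprK -[t]treprK -tclsZ -tclsD.
by rewrite !tlift_cls.
Qed.
HB.instance Definition _ :=
  GRing.isLinear.Build K tens W _ (tlift fl fr) tlift_linear.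

Lemma tlift_pure u v : tlift fl fr (tpure u v) = f u v.
Proof. exact: tlift_cls. Qed.

End Lift.

End Tensor.

Notation "U ⊗ V" := (tens U V) : type_scope.
Notation "u ⊠ v" := (tpure u v) : ring_scope.

Section TensorMap.
Variables (K : fieldType) (U V U' V' : lmodType K).
Variables (f : {linear U -> U'}) (g : {linear V -> V'}).

Definition tmap_fun (u : U) (v : V) : (U' ⊗ V')%type := f u ⊠ g v.

Lemma tmap_linearl v : linear (tmap_fun^~ v).
Proof. by move=> a u u'; rewrite /tmap_fun linearP tpure_linearl. Qed.
Lemma tmap_linearr u : linear (tmap_fun u).
Proof. by move=> a v v'; rewrite /tmap_fun linearP tpure_linearr. Qed.

Definition tmap : {linear (U ⊗ V)%type -> (U' ⊗ V')%type} :=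
  tlift tmap_linearl tmap_linearr.

Lemma tmap_pure u v : tmap (u ⊠ v) = f u ⊠ g v.
Proof. exact: tlift_pure. Qed.

End TensorMap.

Section Functional.
Variables (K : fieldType) (U : lmodType K) (u0 : U).
Hypothesis u0_neq0 : u0 != 0.

Lemma functional_exists : exists f : {linear U -> K^o}, f u0 = 1.
Proof.
pose P (W : set U) := (forall a x y, W x -> W y -> W (a *: x + y)) /\ ~ W u0.
have [F FP tF|W [[Wlin Wu0] Wmax]] := @Zorn_bigcup _ P.
  split=> [a x y [A FA Ax] [B FB By]|[A FA Au]]; last by case: (FP _ FA) => _; apply.
  have [AB|BA] := tF _ _ FA FB.
    by exists B => //; apply: (FP _ FB).1 => //; apply: AB.
  by exists A => //; apply: (FP _ FA).1 => //; apply: BA.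
have W0 : W 0.
  have [//|W0] := pselect (W 0); exfalso; apply: (Wmax [set 0]).
    split; last by move=> sub; apply: W0; apply: sub.
    move=> x Wx; exfalso; apply: W0; rewrite -(subrr x) addrC -scaleN1r.
    exact: Wlin.
  split; first by move=> a x y -> ->; rewrite scaler0 addr0.
  by move=> /= /eqP; apply/negP.
have WZ a x : W x -> W (a *: x) by move=> Wx; rewrite -[_ *: _]addr0; apply: Wlin.
have dec x : exists c, W (x - c *: u0).
  have [Wx|Wx] := pselect (W x); first by exists 0; rewrite scale0r subr0.
  have [[w [c [Ww eu]]]|no] := pselect (exists w c, W w /\ u0 = w + c *: x).
    have c0 : c != 0.
      by apply: contra_notN Wu0 => /eqP c0; rewrite eu c0 scale0r addr0.
    exists c^-1; rewrite eu scalerDr scalerA mulVf // scale1r opprD addrCA subrr addr0.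
    by rewrite -scalerN; apply: (WZ); rewrite -scaleN1r; apply: WZ.
  exfalso; apply: (Wmax [set y | exists w c, W w /\ y = w + c *: x]).
    split; last by move=> sub; apply: Wx; apply: sub; exists 0, 1; rewrite scale1r add0r.
    by move=> y Wy; exists y, 0; rewrite scale0r addr0.
  split=> [a y z [w [c [Ww ->]]] [w' [c' [Ww' ->]]]|//].
  exists (a *: w + w'), (a * c + c'); split; first exact: Wlin.
  by rewrite scalerDr scalerDl scalerA addrACA.
have uniq c c' x : W (x - c *: u0) -> W (x - c' *: u0) -> c = c'.
  move=> h h'; apply/eqP; rewrite -subr_eq0; apply: contra_notT Wu0 => d0.
  have {h h'} : W ((c - c') *: u0).
    have := Wlin (-1) _ _ h h'; congr W.
    by rewrite scaleN1r opprB addrA subrK scalerBl.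
  by move=> /(WZ (c - c')^-1); rewrite scalerA mulVf // scale1r.
pose f x : K^o := projT1 (cid (dec x)).
have fP x : W (x - f x *: u0) by apply: projT2 (cid (dec x)).
have flin : linear f.
  move=> a x y; apply: (uniq _ _ _ (fP _)).
  have := Wlin a _ _ (fP x) (fP y); congr W.
  by rewrite scalerBr addrACA -opprD scalerA -scalerDl.
exists (HB.pack_for {linear U -> K^o} f (GRing.isLinear.Build _ _ _ _ _ flin)) => //=.
by apply: (uniq _ _ _ (fP _)); rewrite scale1r subrr.
Qed.

End Functional.

Section TensorAlgebra.
Variable K : fieldType.

Lemma tens_ind (U V : lmodType K) (P : (U ⊗ V)%type -> Prop) :
  P 0 -> (forall u v, P (u ⊠ v)) -> (forall s t, P s -> P t -> P (s + t)) ->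
  (forall a t, P t -> P (a *: t)) -> forall t, P t.
Proof.
move=> P0 Pp PD PZ t; rewrite -[t]treprK.
elim: (trepr t) => [//|//|s1 IH1 s2 IH2|c s1 IH].
  by rewrite tclsD; apply: PD.
by rewrite tclsZ; apply: PZ.
Qed.

Lemma linear_param (U V X W : lmodType K) (F : X -> {linear (U ⊗ V)%type -> W}) :
  (forall u v, linear (fun x => F x (u ⊠ v))) -> forall t, linear (fun x => F x t).
Proof.
move=> Fl t a x y; elim/tens_ind: t => [|u v|s t IHs IHt|c t IHt].
- by rewrite !(linear0 (F _)) scaler0 addr0.
- exact: Fl.
- by rewrite !(linearD (F _)) IHs IHt scalerDr addrACA.
- by rewrite !(linearZZ (F _)) IHt scalerDr !scalerA mulrC.
Qed.

Variables (A B : algType K).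
Local Notation T := (A ⊗ B)%type.

Definition tens_mul_pure (a : A) (b : B) (a' : A) (b' : B) : T :=
  (a * a') ⊠ (b * b').

Lemma tens_mul_purel a b b' : linear (fun a' => tens_mul_pure a b a' b').
Proof.
by move=> c x y; rewrite /tens_mul_pure mulrDr -scalerAr tpure_linearl.
Qed.
Lemma tens_mul_purer a b a' : linear (tens_mul_pure a b a').
Proof.
by move=> c x y; rewrite /tens_mul_pure mulrDr -scalerAr tpure_linearr.
Qed.

Definition tens_lmul (a : A) (b : B) : {linear T -> T} :=
  tlift (tens_mul_purel a b) (tens_mul_purer a b).

Lemma tens_lmul_linearl (t : T) b : linear (fun a => tens_lmul a b t).
Proof.
apply: (@linear_param _ _ _ _ (fun a => tens_lmul a b)) => u v c x y /=.
by rewrite !tlift_pure /tens_mul_pure mulrDl -scalerAl tpure_linearl.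
Qed.
Lemma tens_lmul_linearr (t : T) a : linear (fun b => tens_lmul a b t).
Proof.
apply: (@linear_param _ _ _ _ (fun b => tens_lmul a b)) => u v c x y /=.
by rewrite !tlift_pure /tens_mul_pure mulrDl -scalerAl tpure_linearr.
Qed.

Definition tens_rmul (t : T) : {linear T -> T} :=
  tlift (tens_lmul_linearl t) (tens_lmul_linearr t).

Definition tens_mul (s t : T) : T := tens_rmul t s.
Definition tens_one : T := 1 ⊠ 1.

Lemma tens_mulE a b a' b' :
  tens_mul (a ⊠ b) (a' ⊠ b') = (a * a') ⊠ (b * b').
Proof. by rewrite /tens_mul /= !tlift_pure. Qed.

Let mul0l t : tens_mul 0 t = 0. Proof. exact: (linear0 (tens_rmul t)). Qed.
Let mulDl : left_distributive tens_mul +%R.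
Proof. by move=> s s' t; apply: (linearD (tens_rmul t)). Qed.
Let mulZl a s t : tens_mul (a *: s) t = a *: tens_mul s t.
Proof. exact: (linearZZ (tens_rmul t)). Qed.

Lemma tens_mul_linearr s : linear (tens_mul s).
Proof.
move=> c x y; elim/tens_ind: s => [|u v|s t IHs IHt|a t IHt].
- by rewrite !mul0l scaler0 addr0.
- by rewrite /tens_mul /= !tlift_pure; apply: linearP.
- by rewrite !mulDl IHs IHt scalerDr addrACA.
- by rewrite !mulZl IHt scalerDr !scalerA mulrC.
Qed.

Let mulDr : right_distributive tens_mul +%R.
Proof. by move=> s t t'; have := tens_mul_linearr s 1 t t'; rewrite !scale1r. Qed.
Let mul0r s : tens_mul s 0 = 0.
Proof. by apply: (addIr (tens_mul s 0)); rewrite -mulDr !add0r. Qed.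
Let mulZr a s t : tens_mul s (a *: t) = a *: tens_mul s t.
Proof. by have := tens_mul_linearr s a t 0; rewrite mul0r !addr0. Qed.

Lemma tens_mulA : associative tens_mul.
Proof.
move=> r s t; elim/tens_ind: r => [|a b|r r' IH IH'|c r IH].
- by rewrite !mul0l.
- elim/tens_ind: s => [|a' b'|s s' IH IH'|c s IH].
  + by rewrite !(mul0l, mul0r).
  + elim/tens_ind: t => [|a'' b''|t t' IH IH'|c t IH].
    * by rewrite !mul0r.
    * by rewrite !tens_mulE !mulrA.
    * by rewrite !mulDr IH IH'.
    * by rewrite !mulZr IH.
  + by rewrite !(mulDl, mulDr) IH IH'.
  + by rewrite !(mulZl, mulZr) IH.
- by rewrite !mulDl IH IH'.
- by rewrite !mulZl IH.
Qed.
Lemma tens_mul1l : left_id tens_one tens_mul.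
Proof.
move=> t; elim/tens_ind: t => [|a b|t t' IH IH'|c t IH].
- by rewrite mul0r.
- by rewrite tens_mulE !mul1r.
- by rewrite mulDr IH IH'.
- by rewrite mulZr IH.
Qed.
Lemma tens_mul1r : right_id tens_one tens_mul.
Proof.
move=> t; elim/tens_ind: t => [|a b|t t' IH IH'|c t IH].
- by rewrite mul0l.
- by rewrite tens_mulE !mulr1.
- by rewrite mulDl IH IH'.
- by rewrite mulZl IH.
Qed.
Lemma tens_one_neq0 : tens_one != 0.
Proof.
have [f f1] := functional_exists (oner_neq0 A).
have [g g1] := functional_exists (oner_neq0 B).
have fgl v : linear (fun u => (f u * g v : K^o)).
  by move=> a x y; rewrite linearP mulrDl -scalerAl.
have fgr u : linear (fun v => (f u * g v : K^o)).
  by move=> a x y; rewrite linearP mulrDr -scalerAr.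
apply/eqP => /(congr1 (tlift fgl fgr)); rewrite linear0 tlift_pure f1 g1 mulr1.
by move/eqP; rewrite oner_eq0.
Qed.

HB.instance Definition _ := GRing.Zmodule_isNzRing.Build T
  tens_mulA tens_mul1l tens_mul1r mulDl mulDr tens_one_neq0.
HB.instance Definition _ := GRing.Lmodule_isLalgebra.Build K T
  (fun a s t => esym (mulZl a s t)).
HB.instance Definition _ := GRing.Lalgebra_isAlgebra.Build K T
  (fun a s t => esym (mulZr a s t)).

Lemma tpureM (a a' : A) (b b' : B) :
  (a ⊠ b) * (a' ⊠ b') = (a * a') ⊠ (b * b') :> T.
Proof. exact: tens_mulE. Qed.

End TensorAlgebra.

Section Opposite.
Variables (K : fieldType) (A : algType K).

HB.instance Definition _ := GRing.Lmodule.copy A^c A.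
HB.instance Definition _ := GRing.Lmodule_isLalgebra.Build K A^c
  (fun a (u v : A^c) => @scalerAr K A a v u).
HB.instance Definition _ := GRing.Lalgebra_isAlgebra.Build K A^c
  (fun a (u v : A^c) => @scalerAl K A a v u).
End Opposite.

(* Linear identities in a K-module are decided coefficient by coefficient. *)
Section LinearCombination.
Variable K : fieldType.

Inductive mexp : Type :=
| MVar of nat
| MZero
| MAdd of mexp & mexp
| MOpp of mexp
| MScale of K & mexp.

Fixpoint mcoef (e : mexp) (i : nat) : K :=
  match e with
  | MVar n => if n == i then 1 else 0
  | MZero => 0
  | MAdd e f => mcoef e i + mcoef f i
  | MOpp e => - mcoef e i
  | MScale c e => c * mcoef e i
  end.

Fixpoint mcoef_eq (e f : mexp) (n : nat) : Prop :=
  if n is n'.+1 then mcoef e n' = mcoef f n' /\ mcoef_eq e f n' else True.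

Variable V : lmodType K.

Fixpoint meval (vs : seq V) (e : mexp) : V :=
  match e with
  | MVar n => vs`_n
  | MZero => 0
  | MAdd e f => meval vs e + meval vs f
  | MOpp e => - meval vs e
  | MScale c e => c *: meval vs e
  end.

Lemma mevalE vs e : meval vs e = \sum_(i < size vs) mcoef e i *: vs`_i.
Proof.
elim: e => [n||e IHe f IHf|e IH|c e IH] /=.
- have [lt|ge] := ltnP n (size vs).
    rewrite (bigD1 (Ordinal lt)) //= eqxx scale1r big1 ?addr0 // => i ni.
    case: eqP => [e|_]; last by rewrite scale0r.
    by case/eqP: ni; apply: val_inj.
  rewrite nth_default // big1 // => i _; case: eqP => [e|_]; last by rewrite scale0r.
  by have := ltn_ord i; rewrite -e ltnNge ge.
- by rewrite big1 // => i _; rewrite scale0r.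
- by rewrite IHe IHf -big_split; apply: eq_bigr => i _; rewrite scalerDl.
- by rewrite IH -sumrN; apply: eq_bigr => i _; rewrite scaleNr.
- by rewrite IH scaler_sumr; apply: eq_bigr => i _; rewrite scalerA.
Qed.

Lemma meval_eq vs e f : mcoef_eq e f (size vs) -> meval vs e = meval vs f.
Proof.
have aux n i : (i < n)%N -> mcoef_eq e f n -> mcoef e i = mcoef f i.
  elim: n => // n IH; rewrite ltnS leq_eqVlt => /orP[/eqP -> []//|lt [_]].
  exact: IH.
by move=> h; rewrite !mevalE; apply: eq_bigr => i _; rewrite (aux (size vs)).
Qed.

End LinearCombination.

(* Atoms are compared up to conversion: the same product can be displayed
   through different instances. *)
Ltac msame v w :=
  match goal with
  | _ => let _ := match goal with _ => constr_eq_nounivs v w end in constr:(true)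
  | _ => let _ := match goal with _ => unify v w end in constr:(true)
  | _ => constr:(false)
  end.
Ltac mlookup v vs :=
  lazymatch vs with
  | nil => constr:(0%N)
  | cons ?w ?l =>
      let b := msame v w in
      lazymatch b with
      | true => constr:(0%N)
      | false => let n := mlookup v l in constr:(S n)
      end
  end.
Ltac mput v vs :=
  lazymatch vs with
  | nil => constr:(cons v nil)
  | cons ?w ?l =>
      let b := msame v w in
      lazymatch b with
      | true => vs
      | false => let l' := mput v l in constr:(cons w l')
      end
  end.
Ltac mvars e vs :=
  lazymatch e with
  | (?a + ?b)%R => let vs' := mvars a vs in mvars b vs'
  | (- ?a)%R => mvars a vs
  | (_ *: ?a)%R => mvars a vs
  | 0%R => vs
  | _ => mput e vs
  end.
Ltac mreify K e vs :=
  lazymatch e with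
  | (?a + ?b)%R =>
      let x := mreify K a vs in let y := mreify K b vs in constr:(@MAdd K x y)
  | (- ?a)%R => let x := mreify K a vs in constr:(@MOpp K x)
  | (?c *: ?a)%R => let x := mreify K a vs in constr:(@MScale K c x)
  | 0%R => constr:(@MZero K)
  | _ => let n := mlookup e vs in constr:(@MVar K n)
  end.
(* Reduces an equality of linear combinations in the K-module V. *)
Ltac mlinear K V :=
  lazymatch goal with
  | |- @eq _ ?a ?b =>
      let vs := mvars a (@nil V) in
      let vs := mvars b vs in
      let x := mreify K a vs in
      let y := mreify K b vs in
      apply: (@meval_eq K V vs x y); rewrite /=; repeat split
  end.

(* Rows and columns are indexed by 'I_2, so that x 0 1 stands for x_12. *)
Section QuantumMatrices.
Variables (K : fieldType) (q : K).

Section Relations.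
Variables (X : Type) (x : 'I_2 -> 'I_2 -> X).
Let x11 : term K X := tgen (x 0 0).
Let x12 : term K X := tgen (x 0 1).
Let x21 : term K X := tgen (x 1 0).
Let x22 : term K X := tgen (x 1 1).
Local Open Scope nc_scope.

Inductive Mq_rel : term K X -> term K X -> Prop :=
| Mq_rel_11_12 : Mq_rel (x11 * x12) (q%:T * (x12 * x11))
| Mq_rel_21_22 : Mq_rel (x21 * x22) (q%:T * (x22 * x21))
| Mq_rel_11_21 : Mq_rel (x11 * x21) (q%:T * (x21 * x11))
| Mq_rel_12_22 : Mq_rel (x12 * x22) (q%:T * (x22 * x12))
| Mq_rel_12_21 : Mq_rel (x12 * x21) (x21 * x12)
| Mq_rel_11_22 : Mq_rel (x11 * x22 + (- 1)%R%:T * (x22 * x11))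
                        ((q - q^-1)%R%:T * (x12 * x21)).

Definition detq_term : term K X := x11 * x22 + (- q)%R%:T * (x12 * x21).

End Relations.

Record is_qmx (B : algType K) (x : 'I_2 -> 'I_2 -> B) : Prop := IsQmx {
  qmx_11_12 : x 0 0 * x 0 1 = q *: (x 0 1 * x 0 0);
  qmx_21_22 : x 1 0 * x 1 1 = q *: (x 1 1 * x 1 0);
  qmx_11_21 : x 0 0 * x 1 0 = q *: (x 1 0 * x 0 0);
  qmx_12_22 : x 0 1 * x 1 1 = q *: (x 1 1 * x 0 1);
  qmx_12_21 : x 0 1 * x 1 0 = x 1 0 * x 0 1;
  qmx_11_22 : x 0 0 * x 1 1 - x 1 1 * x 0 0 = (q - q^-1) *: (x 0 1 * x 1 0) }.

Definition qdet (B : algType K) (x : 'I_2 -> 'I_2 -> B) : B :=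
  x 0 0 * x 1 1 - q *: (x 0 1 * x 1 0).

Lemma Mq_respects (B : algType K) (X : Type) (x : 'I_2 -> 'I_2 -> X) (g : X -> B) :
  is_qmx (fun i j => g (x i j)) <-> respects g (Mq_rel x).
Proof.
split=> [[h1 h2 h3 h4 h5 h6] s t|h].
  case; rewrite /= -?scalerAl ?mul1r //.
  by rewrite scaleN1r.
split.
- by have := h _ _ (Mq_rel_11_12 x); rewrite /= -scalerAl mul1r.
- by have := h _ _ (Mq_rel_21_22 x); rewrite /= -scalerAl mul1r.
- by have := h _ _ (Mq_rel_11_21 x); rewrite /= -scalerAl mul1r.
- by have := h _ _ (Mq_rel_12_22 x); rewrite /= -scalerAl mul1r.
- exact: h _ _ (Mq_rel_12_21 x).
- by have := h _ _ (Mq_rel_11_22 x); rewrite /= -!scalerAl !mul1r scaleN1r.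
Qed.

Lemma teval_detq (B : algType K) (X : Type) (x : 'I_2 -> 'I_2 -> X) (g : X -> B) :
  teval g (detq_term x) = qdet (fun i j => g (x i j)).
Proof. by rewrite /= -scalerAl mul1r scaleNr. Qed.

Lemma tevalM (B : algType K) (X : Type) (g : X -> B) (s t : term K X) :
  teval g (s * t)%nc = teval g s * teval g t.
Proof. by []. Qed.

Lemma is_qmx_delta : is_qmx (fun i j => (i == j)%:R : K^o).
Proof.
by split=> /=; rewrite ?(mulr0, mul0r, mulr1, scaler0, subrr) //.
Qed.

Definition genM (i j : 'I_2) : 'I_2 * 'I_2 := (i, j).
Definition genGL (i j : 'I_2) : option ('I_2 * 'I_2) := Some (i, j).

(* The localization at the quantum determinant: one more generator, None, is
   adjoined as a two-sided inverse of it. *)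
Inductive GLq_rel :
  term K (option ('I_2 * 'I_2)) -> term K (option ('I_2 * 'I_2)) -> Prop :=
| GLq_rel_Mq s t : Mq_rel genGL s t -> GLq_rel s t
| GLq_rel_detV : GLq_rel (detq_term genGL * tgen None)%nc (tcst 1)
| GLq_rel_Vdet : GLq_rel (tgen None * detq_term genGL)%nc (tcst 1).

Lemma nontrivial_of_respects (X : Type) (rel : term K X -> term K X -> Prop)
  (g : X -> K^o) : respects g rel -> ~ tcong rel (tcst 1) (tcst 0).
Proof.
move=> hg /(teval_cong hg) /eqP.
by rewrite /= scale1r scale0r oner_eq0.
Qed.

Lemma Mq_nontrivial : ~ tcong (Mq_rel genM) (tcst 1) (tcst 0).
Proof.
apply: (@nontrivial_of_respects _ _ (fun x => (x.1 == x.2)%:R)).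
by apply/Mq_respects/is_qmx_delta.
Qed.

Definition GLq_map (B : algType K) (x : 'I_2 -> 'I_2 -> B) (d : B)
  (g : option ('I_2 * 'I_2)) : B := if g is Some ij then x ij.1 ij.2 else d.

Lemma GLq_respects (B : algType K) (x : 'I_2 -> 'I_2 -> B) (d : B) :
  is_qmx x -> qdet x * d = 1 -> d * qdet x = 1 -> respects (GLq_map x d) GLq_rel.
Proof.
move=> hx xd dx _ _ [s t||].
- exact: (@Mq_respects _ _ genGL (GLq_map x d)).1.
- by rewrite tevalM teval_detq xd /= scale1r.
- by rewrite tevalM teval_detq dx /= scale1r.
Qed.

Lemma GLq_nontrivial : ~ tcong GLq_rel (tcst 1) (tcst 0).
Proof.
apply: (@nontrivial_of_respects _ _ (GLq_map (fun i j => (i == j)%:R) 1)).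
by apply: GLq_respects is_qmx_delta _ _; rewrite /qdet /= mulr0 scaler0 subr0 !mulr1.
Qed.

Definition Mq : algType K := presented (Presentation Mq_nontrivial).
Definition GLq : algType K := presented (Presentation GLq_nontrivial).

Definition xM (i j : 'I_2) : Mq := @pX K (Presentation Mq_nontrivial) (genM i j).
Definition xGL (i j : 'I_2) : GLq := @pX K (Presentation GLq_nontrivial) (genGL i j).
Definition dinv : GLq := @pX K (Presentation GLq_nontrivial) None.

Lemma xM_qmx : is_qmx xM.
Proof. by apply/Mq_respects; apply: (@pX_respects K (Presentation Mq_nontrivial)). Qed.

Lemma xGL_qmx : is_qmx xGL.
Proof.
apply/(@Mq_respects _ _ genGL (@pX K (Presentation GLq_nontrivial))) => s t st.
by apply: (@pX_respects K (Presentation GLq_nontrivial)); apply: GLq_rel_Mq.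
Qed.

Lemma detqV : qdet xGL * dinv = 1.
Proof.
have := @pX_respects K (Presentation GLq_nontrivial) _ _ GLq_rel_detV.
by rewrite tevalM teval_detq /= scale1r.
Qed.
Lemma detVq : dinv * qdet xGL = 1.
Proof.
have := @pX_respects K (Presentation GLq_nontrivial) _ _ GLq_rel_Vdet.
by rewrite tevalM teval_detq /= scale1r.
Qed.

Definition Mq_lift (B : algType K) (x : 'I_2 -> 'I_2 -> B) (hx : is_qmx x) :
  {lrmorphism Mq -> B} :=
  @plift K (Presentation Mq_nontrivial) B (fun g => x g.1 g.2)
    ((@Mq_respects _ _ genM (fun g => x g.1 g.2)).1 hx).

Definition GLq_lift (B : algType K) (x : 'I_2 -> 'I_2 -> B) (d : B)
  (hx : is_qmx x) (xd : qdet x * d = 1) (dx : d * qdet x = 1) :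
  {lrmorphism GLq -> B} :=
  @plift K (Presentation GLq_nontrivial) B (GLq_map x d) (GLq_respects hx xd dx).

Lemma Mq_liftE (B : algType K) (x : 'I_2 -> 'I_2 -> B) (hx : is_qmx x) i j :
  Mq_lift hx (xM i j) = x i j.
Proof. exact: plift_pX. Qed.

Lemma GLq_liftE (B : algType K) (x : 'I_2 -> 'I_2 -> B) d (hx : is_qmx x)
  (xd : qdet x * d = 1) (dx : d * qdet x = 1) i j :
  GLq_lift hx xd dx (xGL i j) = x i j.
Proof. exact: plift_pX. Qed.

Lemma GLq_lift_dinv (B : algType K) (x : 'I_2 -> 'I_2 -> B) d (hx : is_qmx x)
  (xd : qdet x * d = 1) (dx : d * qdet x = 1) :
  GLq_lift hx xd dx dinv = d.
Proof. exact: plift_pX. Qed.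


Lemma big_ord2 (V : nmodType) (f : 'I_2 -> V) : \sum_k f k = f 0 + f 1.
Proof.
by rewrite big_ord_recl big_ord1; congr (f _ + f _); apply: val_inj.
Qed.

Lemma forall_ord2 (P : 'I_2 -> Prop) : P 0 -> P 1 -> forall i, P i.
Proof.
by move=> P0 P1 [[|[|]] // lt]; [move: P0|move: P1]; congr P; apply: val_inj.
Qed.

Section TensorArith.
Variables (U V : lmodType K).
Lemma tpureDl u u' v : (u + u') ⊠ v = u ⊠ v + u' ⊠ v :> (U ⊗ V)%type.
Proof. by have := tpure_linearl v 1 u u'; rewrite !scale1r. Qed.
Lemma tpureDr u v v' : u ⊠ (v + v') = u ⊠ v + u ⊠ v' :> (U ⊗ V)%type.
Proof. by have := tpure_linearr u 1 v v'; rewrite !scale1r. Qed.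
Lemma tpure0l v : 0 ⊠ v = 0 :> (U ⊗ V)%type.
Proof. by apply: (addIr (0 ⊠ v)); rewrite -tpureDl !add0r. Qed.
Lemma tpure0r u : u ⊠ 0 = 0 :> (U ⊗ V)%type.
Proof. by apply: (addIr (u ⊠ 0)); rewrite -tpureDr !add0r. Qed.
Lemma tpureZl a u v : (a *: u) ⊠ v = a *: (u ⊠ v) :> (U ⊗ V)%type.
Proof. by have := tpure_linearl v a u 0; rewrite tpure0l !addr0. Qed.
Lemma tpureZr a u v : u ⊠ (a *: v) = a *: (u ⊠ v) :> (U ⊗ V)%type.
Proof. by have := tpure_linearr u a v 0; rewrite tpure0r !addr0. Qed.
End TensorArith.

(* The rewriting rules that put a quadratic monomial in the order
   x22, x12, x21, x11. *)
Lemma qmx_order (B : algType K) (x : 'I_2 -> 'I_2 -> B) : is_qmx x ->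
  (x 0 0 * x 0 1 = q *: (x 0 1 * x 0 0)) *
  (x 1 0 * x 1 1 = q *: (x 1 1 * x 1 0)) *
  (x 0 0 * x 1 0 = q *: (x 1 0 * x 0 0)) *
  (x 0 1 * x 1 1 = q *: (x 1 1 * x 0 1)) *
  (x 1 0 * x 0 1 = x 0 1 * x 1 0) *
  (x 0 0 * x 1 1 = x 1 1 * x 0 0 + (q - q^-1) *: (x 0 1 * x 1 0)).
Proof.
case=> h1 h2 h3 h4 h5 h6; do !split=> //.
by rewrite -h6 addrC subrK.
Qed.

Hypothesis q0 : q != 0.

Section Comul.
Variables (A B : algType K) (x : 'I_2 -> 'I_2 -> A) (y : 'I_2 -> 'I_2 -> B).
Hypotheses (hx : is_qmx x) (hy : is_qmx y).

Definition comul_mx (i j : 'I_2) : (A ⊗ B)%type := \sum_k x i k ⊠ y k j.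

Lemma comul_qmx : is_qmx comul_mx.
Proof.
pose T := (A ⊗ B)%type.
have sp := (tpureDl, tpureDr, tpureZl, tpureZr).
split; rewrite /comul_mx !big_ord2 !(mulrDl, mulrDr) !tpureM !(qmx_order hx, qmx_order hy) !sp;
  mlinear K T; by field.
Qed.

Lemma comul_qdet : qdet comul_mx = qdet x ⊠ qdet y.
Proof.
pose T := (A ⊗ B)%type.
have sp := (tpureDl, tpureDr, tpureZl, tpureZr).
rewrite /qdet -!scaleNr.
rewrite /comul_mx !big_ord2 !(mulrDl, mulrDr) !tpureM !(qmx_order hx, qmx_order hy) !sp;
  mlinear K T; by field.
Qed.

End Comul.

Lemma qmx_orderA (B : algType K) (x : 'I_2 -> 'I_2 -> B) (z : B) : is_qmx x ->
  (x 0 0 * (x 0 1 * z) = q *: (x 0 1 * (x 0 0 * z))) *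
  (x 1 0 * (x 1 1 * z) = q *: (x 1 1 * (x 1 0 * z))) *
  (x 0 0 * (x 1 0 * z) = q *: (x 1 0 * (x 0 0 * z))) *
  (x 0 1 * (x 1 1 * z) = q *: (x 1 1 * (x 0 1 * z))) *
  (x 1 0 * (x 0 1 * z) = x 0 1 * (x 1 0 * z)) *
  (x 0 0 * (x 1 1 * z) =
     x 1 1 * (x 0 0 * z) + (q - q^-1) *: (x 0 1 * (x 1 0 * z))).
Proof.
move=> hx; have h := qmx_order hx.
by do !split; rewrite mulrA h ?mulrDl -?scalerAl -?mulrA.
Qed.

Lemma qdet_comm (B : algType K) (x : 'I_2 -> 'I_2 -> B) (hx : is_qmx x) i j :
  qdet x * x i j = x i j * qdet x.
Proof.
have hA z := qmx_orderA z hx; have h := qmx_order hx.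
have sp := (scalerDr, @scalerAl K B, @scalerAr K B).
move: i j; apply: forall_ord2; apply: forall_ord2; rewrite /qdet -!scaleNr;
  rewrite !(mulrDl, mulrDr) -?scalerAl -?scalerAr -?mulrA;
  do 4! rewrite ?(hA, h) ?mulrDr -?scalerAr;
  mlinear K B; by field.
Qed.

Lemma qdetV_comm (B : algType K) (x : 'I_2 -> 'I_2 -> B) d (hx : is_qmx x)
  (xd : qdet x * d = 1) (dx : d * qdet x = 1) i j : x i j * d = d * x i j.
Proof.
have -> : d * x i j = d * (x i j * qdet x) * d by rewrite -!mulrA xd mulr1.
by rewrite -qdet_comm // mulrA dx mul1r.
Qed.

Definition to_GLq : {lrmorphism Mq -> GLq} := Mq_lift xGL_qmx.

Definition comulM : {lrmorphism Mq -> (Mq ⊗ Mq)%type} :=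
  Mq_lift (comul_qmx xM_qmx xM_qmx).

Lemma comul_qdetV :
  qdet (comul_mx xGL xGL) * (dinv ⊠ dinv) = 1 :> (GLq ⊗ GLq)%type.
Proof. by rewrite (comul_qdet xGL_qmx xGL_qmx) tpureM detqV. Qed.
Lemma comul_Vqdet :
  (dinv ⊠ dinv) * qdet (comul_mx xGL xGL) = 1 :> (GLq ⊗ GLq)%type.
Proof. by rewrite (comul_qdet xGL_qmx xGL_qmx) tpureM detVq. Qed.

Definition comulGL : {lrmorphism GLq -> (GLq ⊗ GLq)%type} :=
  GLq_lift (comul_qmx xGL_qmx xGL_qmx) comul_qdetV comul_Vqdet.

Definition antipode_mx (i j : 'I_2) : GLq :=
  if i == 0 then
    if j == 0 then xGL 1 1 * dinv else (- q^-1) *: (xGL 0 1 * dinv)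
  else
    if j == 0 then (- q) *: (xGL 1 0 * dinv) else xGL 0 0 * dinv.

Let dc i j : xGL i j * dinv = dinv * xGL i j.
Proof. exact: qdetV_comm xGL_qmx detqV detVq i j. Qed.
Let dcA i j z : xGL i j * (dinv * z) = dinv * (xGL i j * z).
Proof. by rewrite mulrA dc mulrA. Qed.

Lemma is_qmx_op (B : algType K) (y : 'I_2 -> 'I_2 -> B) :
  y 0 1 * y 0 0 = q *: (y 0 0 * y 0 1) ->
  y 1 1 * y 1 0 = q *: (y 1 0 * y 1 1) ->
  y 1 0 * y 0 0 = q *: (y 0 0 * y 1 0) ->
  y 1 1 * y 0 1 = q *: (y 0 1 * y 1 1) ->
  y 1 0 * y 0 1 = y 0 1 * y 1 0 ->
  y 1 1 * y 0 0 - y 0 0 * y 1 1 = (q - q^-1) *: (y 1 0 * y 0 1) ->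
  is_qmx (y : 'I_2 -> 'I_2 -> B^c).
Proof. by []. Qed.

Lemma antipode_qmx : is_qmx (antipode_mx : 'I_2 -> 'I_2 -> GLq^c).
Proof.
have h := qmx_order xGL_qmx.
by apply: is_qmx_op; rewrite /antipode_mx /=;
  rewrite -?scalerAl -?scalerAr -!mulrA ?dc ?dcA ?h ?mulrDr -?scalerAr;
  mlinear K GLq; field.
Qed.

Lemma antipode_qdet : qdet (antipode_mx : 'I_2 -> 'I_2 -> GLq^c) = dinv.
Proof.
change (antipode_mx 1 1 * antipode_mx 0 0
  - q *: (antipode_mx 1 0 * antipode_mx 0 1) = dinv).
have -> : dinv = dinv * (dinv * qdet xGL) by rewrite detVq mulr1.
rewrite /antipode_mx /qdet /= -!scaleNr -?scalerAl -?scalerAr -!mulrA ?dc ?dcA.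
rewrite !mulrDr -!scalerAr (qmx_12_21 xGL_qmx); mlinear K GLq; by field.
Qed.

Lemma antipode_qdinv :
  qdet (antipode_mx : 'I_2 -> 'I_2 -> GLq^c) * (qdet xGL : GLq^c) = 1.
Proof. by rewrite antipode_qdet; apply: detqV. Qed.
Lemma antipode_Vqdet :
  (qdet xGL : GLq^c) * qdet (antipode_mx : 'I_2 -> 'I_2 -> GLq^c) = 1.
Proof. by rewrite antipode_qdet; apply: detVq. Qed.

(* The antipode is an algebra morphism to the opposite algebra. *)
Definition antipode_op : {lrmorphism GLq -> GLq^c} :=
  GLq_lift antipode_qmx antipode_qdinv antipode_Vqdet.

Definition antipode (h : GLq) : GLq := antipode_op h.

Lemma antipode_linear : linear antipode.
Proof. exact: linearP antipode_op. Qed.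

Lemma comulM_x i j : comulM (xM i j) = \sum_k xM i k ⊠ xM k j.
Proof. exact: Mq_liftE. Qed.

Lemma comulGL_x i j : comulGL (xGL i j) = \sum_k xGL i k ⊠ xGL k j.
Proof. exact: GLq_liftE. Qed.

Lemma comulGL_dinv : comulGL dinv = dinv ⊠ dinv.
Proof. exact: GLq_lift_dinv. Qed.

Lemma antipode_x i j : antipode (xGL i j) = antipode_mx i j.
Proof. exact: (GLq_liftE antipode_qmx antipode_qdinv antipode_Vqdet). Qed.

Lemma antipode_dinv : antipode dinv = qdet xGL.
Proof. exact: (GLq_lift_dinv antipode_qmx antipode_qdinv antipode_Vqdet). Qed.

Lemma antipodeM a b : antipode (a * b) = antipode b * antipode a.
Proof. exact: (rmorphM antipode_op). Qed.

(* h |-> h_1 ⊗ (h_2 ⊗ h_3) *)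
Definition comul3 : {linear Mq -> (Mq ⊗ (Mq ⊗ Mq))%type} :=
  tmap idfun comulM \o comulM.

Section Coaction.
Variable p : GLq -> GLq -> GLq.
Hypotheses (pl : forall b, linear (p^~ b)) (pr : forall a, linear (p a)).

Definition coact_pure (h1 h2 h3 : Mq) : (Mq ⊗ GLq)%type :=
  h2 ⊠ p (antipode (to_GLq h1)) (to_GLq h3).

Lemma coact_purel h1 h3 : linear (fun h2 => coact_pure h1 h2 h3).
Proof. exact: tpure_linearl. Qed.
Lemma coact_purer h1 h2 : linear (coact_pure h1 h2).
Proof. by move=> a x y; rewrite /coact_pure linearP pr tpure_linearr. Qed.

Definition coact1 (h1 : Mq) : {linear (Mq ⊗ Mq)%type -> (Mq ⊗ GLq)%type} :=
  tlift (coact_purel h1) (coact_purer h1).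

Lemma coact1_linearl t : linear (fun h1 => coact1 h1 t).
Proof.
apply: (@linear_param _ _ _ _ _ coact1) => h2 h3 a x y.
by rewrite /= !tlift_pure /coact_pure linearP antipode_linear pl tpure_linearr.
Qed.
Lemma coact1_linearr h1 : linear (coact1 h1).
Proof. exact: linearP. Qed.

(* h_1 ⊗ (h_2 ⊗ h_3) |-> h_2 ⊗ p (S h_1) h_3 *)
Definition coact3 : {linear (Mq ⊗ (Mq ⊗ Mq))%type -> (Mq ⊗ GLq)%type} :=
  tlift coact1_linearl coact1_linearr.

Lemma coact3_pure h1 h2 h3 :
  coact3 (h1 ⊠ (h2 ⊠ h3)) = h2 ⊠ p (antipode (to_GLq h1)) (to_GLq h3).
Proof. by rewrite /= !tlift_pure. Qed.

End Coaction.

Lemma mul_linearl (b : GLq) : linear (fun a => a * b).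
Proof. by move=> c x y; rewrite mulrDl scalerAl. Qed.
Lemma mul_linearr (a : GLq) : linear (fun b => a * b).
Proof. by move=> c x y; rewrite mulrDr scalerAr. Qed.

(* beta_coaction h = h_2 ⊗ S(h_1) h_3 and alpha_coaction h = h_2 ⊗ h_3 S(h_1) *)
Definition beta_coaction : {linear Mq -> (Mq ⊗ GLq)%type} :=
  coact3 mul_linearl mul_linearr \o comul3.
Definition alpha_coaction : {linear Mq -> (Mq ⊗ GLq)%type} :=
  coact3 (p := fun a b => b * a) mul_linearr mul_linearl \o comul3.

Section CoOrbit.
Variables (xi : 'M[K]_2) (hxi : is_qmx (xi : 'I_2 -> 'I_2 -> K^o)).

Definition eval_at : {lrmorphism Mq -> K^o} := Mq_lift hxi.

Lemma ev_purel (h : GLq) : linear (fun a => eval_at a *: h).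
Proof. by move=> c x y; rewrite linearP scalerDl scalerA. Qed.
Lemma ev_purer a : linear (fun h : GLq => eval_at a *: h).
Proof. by move=> c x y; rewrite scalerDr !scalerA mulrC. Qed.

(* eval_at ⊗ id, with K ⊗ GLq identified with GLq *)
Definition ev_id : {linear (Mq ⊗ GLq)%type -> GLq} := tlift ev_purel ev_purer.

Definition beta_orbit : {linear Mq -> GLq} := ev_id \o beta_coaction.
Definition alpha_orbit : {linear Mq -> GLq} := ev_id \o alpha_coaction.

End CoOrbit.

Definition nilp_mx (xi1 : K) : 'M[K]_2 := xi1 *: delta_mx 0 1.

Lemma nilp_qmx (xi1 : K) : is_qmx (nilp_mx xi1 : 'I_2 -> 'I_2 -> K^o).
Proof.
by split; rewrite !mxE /= ?(mulr0, mul0r, scaler0, subrr) //.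
Qed.

Definition tau1 : Mq := q ^- 2 *: xM 0 0 + q ^- 4 *: xM 1 1.
Definition tau2 : Mq := q ^- 6 *: qdet xM.
Definition sigma1 : Mq := xM 0 0 + xM 1 1.
Definition sigma2 : Mq := qdet xM.

End QuantumMatrices.

Section Subspaces.
Variables (K : fieldType) (A : algType K).

Definition is_subalgebra (B : set A) := GRing.subalg_closed [in B].

Definition subalgebra_gen (G : set A) : set A := smallest is_subalgebra G.

Definition is_right_ideal (I : set A) :=
  [/\ I 0, forall a b, I a -> I b -> I (a + b) & forall a b, I a -> I (a * b)].

Definition right_ideal_gen (G : set A) : set A := smallest is_right_ideal G.

(* The image of B ⊗ A in A ⊗ A, which is B ⊗ A as K is a field. *)
Definition tens_left (B : set A) : set (A ⊗ A)%type :=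
  smallest (fun W => GRing.submod_closed [in W]) [set b ⊠ a | b in B & a in setT].

Definition is_right_coideal_subalgebra (D : A -> (A ⊗ A)%type) (B : set A) :=
  is_subalgebra B /\ D @` B `<=` tens_left B.

End Subspaces.

(* Main.v *)
Require Import Defs.
From mathcomp Require Import all_boot all_algebra.
From mathcomp Require Import boolp classical_sets reals.
From mathcomp Require Import complex ring.

(* For g in O(M_q) one has beta^xi(g x_ij) = xi1 S(x_i1) beta^xi(g) x_2j, so
   ker(beta^xi) is a right ideal; it contains x11 + q^-2 x22 and det_q.  Modulo
   the right ideal they generate, O(M_q) is spanned by x11^e x12^i x21^j with e
   in {0, 1}, and such a monomial is sent to a nonzero multiple of
   x21^(e+2j) x22^(e+2i) det_q^-(e+i+j).  These elements span the subalgebra of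
   the claim, and they are linearly independent in O(GL_q): this is seen in the
   representations on K^(N+1) in which x21 is a multiple of a nilpotent shift, x22
   is diagonal and x12 = 0, rescaled by a parameter lam that separates the total
   degrees.  For alpha^xi the same argument applies to the opposite algebra of
   O(M_q), which satisfies the relations with q^-1 in place of q. *)

Set Implicit Arguments.
Unset Strict Implicit.
Unset Printing Implicit Defensive.

Import GRing.Theory.
Local Open Scope ring_scope.
Local Open Scope classical_set_scope.

(** * Linear spans and freeness of indexed families *)

Section LinearSpan.
Variables (K : fieldType) (T : eqType) (V : lmodType K) (m : T -> V).

Definition lin_span : set V :=
  [set v | exists s : seq (K * T), v = \sum_(p <- s) p.1 *: m p.2].

Lemma lin_span0 : lin_span 0.
Proof. by exists [::]; rewrite big_nil. Qed.

Lemma lin_span_gen t : lin_span (m t).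
Proof. by exists [:: (1, t)]; rewrite big_seq1 scale1r. Qed.

Lemma lin_spanZ k v : lin_span v -> lin_span (k *: v).
Proof.
case=> s ->; exists [seq (k * p.1, p.2) | p <- s].
by rewrite big_map scaler_sumr; apply: eq_bigr => p _; rewrite scalerA.
Qed.

Lemma lin_spanD v w : lin_span v -> lin_span w -> lin_span (v + w).
Proof. by case=> s -> [s' ->]; exists (s ++ s'); rewrite big_cat. Qed.

Lemma lin_span_min (P : V -> Prop) : P 0 -> (forall v w, P v -> P w -> P (v + w)) ->
  (forall k t, P (k *: m t)) -> forall v, lin_span v -> P v.
Proof.
move=> P0 PD Pm v [s ->]; elim: s => [|p s IH]; first by rewrite big_nil.
by rewrite big_cons; apply: PD.
Qed.

(** A list may repeat an index, so the coefficient of [t] is the sum over all its occurrences in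
    [s]. *)
Definition lin_free : Prop := forall s : seq (K * T),
  \sum_(p <- s) p.1 *: m p.2 = 0 -> forall t, \sum_(p <- s | p.2 == t) p.1 = 0.

End LinearSpan.

(* Up to nonzero scalars the monomials below commute, which makes the powers of
   q irrelevant. *)
Section Proportional.
Variable K : fieldType.

Definition prop_to (V : lmodType K) (x y : V) := exists2 k : K, k != 0 & x = k *: y.

Section Module.
Variable V : lmodType K.
Implicit Types x y z : V.

Lemma prop_to_refl x : prop_to x x.
Proof. by exists 1; rewrite ?oner_neq0 ?scale1r. Qed.

Lemma prop_to_sym x y : prop_to x y -> prop_to y x.
Proof.
by case=> k k0 ->; exists k^-1; rewrite ?invr_eq0 // scalerA mulVf // scale1r.
Qed.

Lemma prop_to_trans y x z : prop_to x y -> prop_to y z -> prop_to x z.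
Proof.
by case=> k k0 -> [l l0 ->]; exists (k * l); rewrite ?mulf_neq0 // scalerA.
Qed.

Lemma prop_toZ k x : k != 0 -> prop_to (k *: x) x.
Proof. by exists k. Qed.

End Module.

Section Algebra.
Variable A : algType K.
Implicit Types x y z w : A.

Lemma prop_toM x y z w : prop_to x y -> prop_to z w -> prop_to (x * z) (y * w).
Proof.
case=> k k0 -> [l l0 ->]; exists (k * l); first by rewrite mulf_neq0.
by rewrite -scalerAl -scalerAr scalerA.
Qed.

Lemma prop_toMl x y z : prop_to x y -> prop_to (z * x) (z * y).
Proof. by move=> xy; apply: prop_toM xy; apply: prop_to_refl. Qed.

Lemma prop_toMr x y z : prop_to x y -> prop_to (x * z) (y * z).
Proof. by move=> xy; apply: (prop_toM xy); apply: prop_to_refl. Qed.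

Lemma prop_toC_exp x y n : prop_to (x * y) (y * x) -> prop_to (x ^+ n * y) (y * x ^+ n).
Proof.
move=> xy; elim: n => [|n IH]; first by rewrite mul1r mulr1; apply: prop_to_refl.
rewrite exprS -mulrA; apply: prop_to_trans (prop_toMl _ IH) _.
by rewrite !mulrA; apply: prop_toMr.
Qed.

End Algebra.
End Proportional.

(** Injectivity of [g] keeps distinct indices apart in the image, so freeness of [E] kills each
    collected coefficient up to a nonzero factor. No freeness of [m] is assumed: the conclusion is
    only that [f] is injective on the span. *)
Lemma lin_free_inj (K : fieldType) (T S : eqType) (V W : lmodType K)
    (m : T -> V) (E : S -> W) (g : T -> S) (f : {linear V -> W}) :
  lin_free E -> injective g -> (forall t, prop_to (f (m t)) (E (g t))) ->
  forall v, lin_span m v -> f v = 0 -> v = 0.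
Proof.
move=> freeE inj_g fm v [s ->] fv0.
have /choice [k kP] t : exists k : K, k != 0 /\ f (m t) = k *: E (g t).
  by have [k k0 fmt] := fm t; exists k.
have {}fv0 : \sum_(p <- [seq (p.1 * k p.2, g p.2) | p <- s]) p.1 *: E p.2 = 0.
  rewrite -[RHS]fv0 big_map linear_sum; apply: eq_bigr => p _ /=.
  by rewrite linearZ /= (kP _).2 scalerA.
(* Repeated indices are grouped, so that [freeE] can be applied to one index at a time. *)
transitivity (\sum_(t <- undup [seq p.2 | p <- s]) (\sum_(p <- s | p.2 == t) p.1) *: m t).
  under [RHS]eq_bigr do rewrite scaler_suml.
  rewrite (exchange_big_dep xpredT) //= !big_seq; apply: eq_bigr => p sp.
  rewrite big_mkcond (bigD1_seq p.2) ?undup_uniq ?mem_undup ?map_f //= eqxx.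
  by rewrite big1 ?addr0 // => t; rewrite eq_sym => /negPf ->.
apply: big1_seq => t _; have := freeE _ fv0 (g t).
rewrite big_map /= (eq_bigl (fun p => p.2 == t)) => [|p]; last exact: inj_eq.
under eq_bigr => p /eqP -> do [].
rewrite -mulr_suml => /eqP; rewrite mulf_eq0 (negPf (kP t).1) orbF => /eqP ->.
by rewrite scale0r.
Qed.
(* An induction principle that, unlike right multiplication by the generators,
   is invariant under passing to the opposite algebra. *)
Definition generates (K : fieldType) (A : algType K) (a : 'I_2 -> 'I_2 -> A) :=
  forall P : A -> Prop, (forall k : K, P k%:A) -> (forall i j, P (a i j)) ->
  (forall g h, P g -> P h -> P (g + h)) -> (forall g h, P g -> P h -> P (g * h)) ->
  forall h, P h.

(* (e, i, j) indexes a_00^e a_01^i a_10^j in pmono below, and pm_exp gives the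
   exponents of x_21 and x_22 in its image under the co-orbit map. *)
Definition pm_index := (bool * nat * nat)%type.
Definition pm_exp (t : pm_index) : nat * nat := (t.1.1 + t.2.*2, t.1.1 + t.1.2.*2)%N.

(** The parity of the first exponent recovers [e]; halving the rest recovers [j] and [i]. *)
Lemma pm_exp_inj : injective pm_exp.
Proof.
move=> [[e i] j] [[e' i'] j'] [/= hj hi].
have ee : e = e' by move/(congr1 odd): hj; rewrite !oddD !odd_double !addbF !oddb.
by move: hi hj; rewrite -ee => /addnI/double_inj-> /addnI/double_inj->.
Qed.

(** * Range and kernel of an abstract co-orbit map at a nilpotent point *)

Section NilpotentOrbit.
Variables (K : fieldType) (A : algType K) (W : lmodType K) (q c : K).
Variables (a : 'I_2 -> 'I_2 -> A) (f : {linear A -> W}).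
Variables (op : 'I_2 -> 'I_2 -> W -> W) (E : nat * nat -> W).
Hypotheses (q0 : q != 0) (c0 : c != 0) (qa : is_qmx q a) (gen_a : generates a).

(** The scalar [c] lets one argument serve both coactions: it is [q ^- 2] for beta and 1 for
    alpha. *)
Let tau := a 0 0 + c *: a 1 1.
Let det := qdet q a.

Definition pmono (t : pm_index) : A := a 0 0 ^+ t.1.1 * a 0 1 ^+ t.1.2 * a 1 0 ^+ t.2.

Let I : set A := [set h | exists g g', h = tau * g + det * g'].

Let ID g h : I g -> I h -> I (g + h).
Proof.
case=> u [u' ->] [v [v' ->]]; exists (u + v), (u' + v').
by rewrite !mulrDr addrACA.
Qed.
Let IM g h : I g -> I (g * h).
Proof.
by case=> u [u' ->]; exists (u * h), (u' * h); rewrite mulrDl !mulrA.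
Qed.
Let Itau h : I (tau * h).
Proof. by exists h, 0; rewrite mulr0 addr0. Qed.
Let Idet h : I (det * h).
Proof. by exists 0, h; rewrite mulr0 add0r. Qed.
Let IZ k h : I h -> I (k *: h).
Proof. by move=> Ih; rewrite -[h]mulr1 scalerAr; apply: IM. Qed.

(** The sum of the right ideal [I] and the span of the normal monomials; [S_all] shows that it is
    everything. *)
Let S : set A := [set h | exists g r, [/\ I g, lin_span pmono r & h = g + r]].

Let SI h : I h -> S h.
Proof. by move=> Ih; exists h, 0; split; rewrite ?addr0 //; apply: lin_span0. Qed.
Let SD g h : S g -> S h -> S (g + h).
Proof.
case=> u [r [Iu r_s ->]] [v [s [Iv s_s ->]]]; exists (u + v), (r + s).
by split; [apply: ID|apply: lin_spanD|rewrite addrACA].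
Qed.
Let SZ k h : S h -> S (k *: h).
Proof.
case=> u [r [Iu r_s ->]]; exists (k *: u), (k *: r).
by split; [apply: IZ|apply: lin_spanZ|rewrite scalerDr].
Qed.
Let S_prop g h : prop_to g h -> S h -> S g.
Proof. by case=> k _ ->; apply: SZ. Qed.
Let Smono e i j : S (a 0 0 ^+ (e : bool) * a 0 1 ^+ i * a 1 0 ^+ j).
Proof.
exists 0, (pmono (e, i, j)); split; rewrite ?add0r //; last exact: lin_span_gen.
by exists 0, 0; rewrite !mulr0 addr0.
Qed.

Let a01_a00 : prop_to (a 0 1 * a 0 0) (a 0 0 * a 0 1).
Proof. by apply: prop_to_sym; rewrite (qmx_11_12 qa); apply: prop_toZ. Qed.
Let a10_a00 : prop_to (a 1 0 * a 0 0) (a 0 0 * a 1 0).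
Proof. by apply: prop_to_sym; rewrite (qmx_11_21 qa); apply: prop_toZ. Qed.
Let a01_a11 : prop_to (a 0 1 * a 1 1) (a 1 1 * a 0 1).
Proof. by rewrite (qmx_12_22 qa); apply: prop_toZ. Qed.
Let a10_a11 : prop_to (a 1 0 * a 1 1) (a 1 1 * a 1 0).
Proof. by rewrite (qmx_21_22 qa); apply: prop_toZ. Qed.

Let mono_comm x i j : prop_to (a 0 1 * x) (x * a 0 1) ->
  prop_to (a 1 0 * x) (x * a 1 0) ->
  prop_to (a 0 1 ^+ i * a 1 0 ^+ j * x) (x * (a 0 1 ^+ i * a 1 0 ^+ j)).
Proof.
move=> h01 h10; rewrite -mulrA.
apply: prop_to_trans (prop_toMl _ (prop_toC_exp _ h10)) _.
by rewrite !mulrA; apply/prop_toMr/prop_toC_exp.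
Qed.

Let a11_a00 : a 1 1 * a 0 0 = det + q^-1 *: (a 0 1 * a 1 0).
Proof.
have -> : a 1 1 * a 0 0 = a 0 0 * a 1 1 - (q - q^-1) *: (a 0 1 * a 1 0).
  by rewrite -(qmx_11_22 qa) opprB addrC subrK.
by rewrite /det /qdet; mlinear K A; ring.
Qed.
Let a00_a11 : a 0 0 * a 1 1 = det + q *: (a 0 1 * a 1 0).
Proof. by rewrite /det /qdet subrK. Qed.

Let a01_a10_mono i j : a 0 1 * a 1 0 * (a 0 1 ^+ i * a 1 0 ^+ j) =
  a 0 1 ^+ i.+1 * a 1 0 ^+ j.+1.
Proof.
have c10_01 : GRing.comm (a 1 0) (a 0 1) := esym (qmx_12_21 qa).
by rewrite -mulrA [a 1 0 * _]mulrA (commrX _ c10_01) -mulrA -exprS mulrA -exprS.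
Qed.

(** As [I] is only a right ideal, [tau] and [det] must appear on the left. So a factor [a 0 0] or
    [a 1 1] is first moved left past [M], at the cost of a nonzero scalar. There [tau] exchanges the
    two diagonal entries up to a scalar, and [det] turns their product into a multiple of
    [a 0 1 * a 1 0]. *)
Let S_mono_mul e i j k l :
  S (a 0 0 ^+ (e : bool) * a 0 1 ^+ i * a 1 0 ^+ j * a k l).
Proof.
pose M := a 0 1 ^+ i * a 1 0 ^+ j.
have c01_10 : GRing.comm (a 0 1) (a 1 0) := qmx_12_21 qa.
have SM b : S (a 0 0 ^+ (b : bool) * M) by rewrite mulrA; apply: Smono.
have S2 : S (a 0 1 * a 1 0 * M).
  by rewrite a01_a10_mono -[_ * _]mul1r mulrA; apply: (Smono false).
move: k l; apply: forall_ord2; apply: forall_ord2.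
- rewrite -!mulrA [X in S (_ * X)]mulrA.
  apply: S_prop (prop_toMl _ (mono_comm i j a01_a00 a10_a00)) _.
  case: e; last by rewrite expr0 mul1r; apply: (SM true).
  (* The left factor is replaced by [tau - c *: a 1 1], which leaves [a 1 1 * a 0 0] to be reduced
     by [det]. *)
  have -> : a 0 0 ^+ true * (a 0 0 * M) =
      tau * (a 0 0 * M) + (- c) *: (det * M + q^-1 *: (a 0 1 * a 1 0 * M)).
    rewrite expr1 [in RHS]/tau mulrDl -scalerAl [a 1 1 * _]mulrA a11_a00.
    by rewrite [in RHS]mulrDl -scalerAl scaleNr addrK.
  by apply: SD; [apply: SI|apply: SZ; apply: SD; [apply: SI|apply: SZ]].
- rewrite -mulrA -(commrX _ c01_10) mulrA -[_ * _ * a 0 1]mulrA -exprSr.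
  exact: Smono.
- by rewrite -mulrA -exprSr; apply: Smono.
- rewrite -!mulrA [X in S (_ * X)]mulrA.
  apply: S_prop (prop_toMl _ (mono_comm i j a01_a11 a10_a11)) _.
  case: e; rewrite ?expr0 ?expr1 ?mul1r.
    rewrite mulrA a00_a11 mulrDl -scalerAl.
    by apply: SD; [apply: SI|apply: SZ].
  have -> : a 1 1 * M = c^-1 *: (tau * M + -1 *: (a 0 0 * M)).
    rewrite /tau mulrDl -scalerAl scaleN1r addrAC subrr add0r scalerA.
    by rewrite mulVf // scale1r.
  by apply: SZ; apply: SD; [apply: SI|apply: SZ (SM true)].
Qed.

(** [S] contains 1 and is stable under right multiplication by the generators. The induction on [h]
    keeps the left factor arbitrary, so that stability passes to products. *)
Let S_all h : S h.
Proof.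
suff SM : forall g, S g -> S (g * h).
  rewrite -[h]mul1r; apply: SM.
  by rewrite -[1]mulr1 -[1 * 1]mulr1; apply: (Smono false 0 0).
move: h; apply: gen_a => [k|k l|g h IHg IHh|g h IHg IHh] r.
- by move=> Sr; rewrite -scalerAr mulr1; apply: SZ.
- case=> u [v [Iu vs ->]]; rewrite mulrDl; apply: SD; first exact/SI/IM.
  move: v vs; apply: lin_span_min => [|v w Sv Sw|b [[e i] j]].
  + by rewrite mul0r; apply/SI; rewrite -(mulr0 tau).
  + by rewrite mulrDl; apply: SD.
  + by rewrite -scalerAl; apply: SZ; apply: S_mono_mul.
- by move=> Sr; rewrite mulrDr; apply: SD; [apply: IHg|apply: IHh].
- by move=> Sr; rewrite mulrA; apply/IHh/IHg.
Qed.

Hypotheses (fM : forall g i j, f (g * a i j) = op i j (f g)).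
Hypothesis opZ : forall i j k w, op i j (k *: w) = k *: op i j w.
Hypotheses (ftau : f tau = 0) (fdet : f det = 0).
Hypothesis f1 : prop_to (f 1) (E (0, 0)%N).
Hypotheses (op00 : prop_to (op 0 0 (E (0, 0)%N)) (E (1, 1)%N))
  (op01 : forall m n, prop_to (op 0 1 (E (m, n))) (E (m, n.+2)))
  (op10 : forall m n, prop_to (op 1 0 (E (m, n))) (E (m.+2, n))).
Hypothesis freeE : lin_free E.

(** The kernel is a right ideal because [f (g * a i j)] depends on [g] only through [f g]. *)
Let fmul0 g h : f g = 0 -> f (g * h) = 0.
Proof.
move: h g; apply: gen_a => [k|i j|g h IHg IHh|g h IHg IHh] r fr.
- by rewrite -scalerAr mulr1 linearZ /= fr scaler0.
(* Homogeneity at the scalar 0 gives that [op i j] fixes 0. *)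
- by rewrite fM fr -(scale0r (0 : W)) opZ !scale0r.
- by rewrite mulrDr linearD /= IHg // IHh // addr0.
- by rewrite mulrA IHh // IHg.
Qed.

Let fI h : I h -> f h = 0.
Proof. by case=> u [v ->]; rewrite linearD /= !fmul0 // addr0. Qed.

Let fop g i j w w' : prop_to (f g) w -> prop_to (op i j w) w' -> prop_to (f (g * a i j)) w'.
Proof.
rewrite fM => -[k k0 ->] ww'; rewrite opZ.
by apply: prop_to_trans ww'; apply: prop_toZ.
Qed.

(** The word is built from left to right by right multiplications. The factor [a 0 0] comes first
    and at most once, which is why [op 0 0] is prescribed only on [E (0, 0)]. *)
Lemma orbit_pmono t : prop_to (f (pmono t)) (E (pm_exp t)).
Proof.
case: t => [[e i] j]; rewrite /pmono /pm_exp /=.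
elim: j => [|j IH]; last first.
  by rewrite exprSr mulrA doubleS !addnS; apply: fop IH (op10 _ _).
rewrite mulr1 addn0; elim: i => [|i IH]; last first.
  by rewrite exprSr mulrA doubleS !addnS; apply: fop IH (op01 _ _).
rewrite mulr1 addn0; case: e; last exact: f1.
by rewrite expr1 -[a 0 0]mul1r; apply: fop f1 op00.
Qed.

Lemma nilpotent_orbit_range : range f = lin_span (E \o pm_exp).
Proof.
apply/seteqP; split=> [w [h _ <-]|w].
  have [u [v [/fI fu vs ->]]] := S_all h; rewrite linearD /= fu add0r.
  move: v vs; apply: lin_span_min => [|v v' IH IH'|k t].
  - by rewrite linear0; apply: lin_span0.
  - by rewrite linearD; apply: lin_spanD.
  - rewrite linearZ /=; have [l l0 ->] := orbit_pmono t.
    by apply/lin_spanZ/lin_spanZ/lin_span_gen.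
move: w; apply: lin_span_min => [|_ _ [g _ <-] [h _ <-]|k t].
- by exists 0; rewrite ?linear0.
- by exists (g + h); rewrite ?linearD.
- have [l l0 Et] := prop_to_sym (orbit_pmono t).
  by exists (k *: (l *: pmono t)) => //; rewrite linearZ /= linearZ /= -Et.
Qed.

(** Modulo [I], [h] is a combination of normal monomials, whose images are multiples of distinct
    members of the free family [E]; hence [f] is injective on their span. *)
Lemma nilpotent_orbit_ker h : f h = 0 <-> exists g g', h = tau * g + det * g'.
Proof.
split=> [|/fI//]; have [u [v [Iu vs ->]]] := S_all h.
rewrite linearD /= (fI Iu) add0r => fv; suff -> : v = 0 by rewrite addr0.
exact: lin_free_inj freeE pm_exp_inj orbit_pmono _ vs fv.
Qed.

End NilpotentOrbit.

(** * Recursion formulas for the co-orbit maps at an arbitrary point *)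

Section OrbitMaps.
Variables (K : fieldType) (q : K) (q0 : q != 0).
Variables (xi : 'M[K]_2) (hxi : is_qmx q (xi : 'I_2 -> 'I_2 -> K^o)).

Lemma tmapM (A B A' B' : algType K) (f : {linear A -> A'}) (g : {linear B -> B'}) :
  {morph f : x y / x * y} -> {morph g : x y / x * y} -> {morph tmap f g : s t / s * t}.
Proof.
move=> fM gM s t; elim/tens_ind: s => [|a b|s s' IH IH'|k s IH].
- by rewrite mul0r linear0 mul0r.
- elim/tens_ind: t => [|a' b'|t t' IH IH'|k t IH].
  + by rewrite mulr0 linear0 mulr0.
  + by rewrite tpureM !tmap_pure tpureM fM gM.
  + by rewrite mulrDr !linearD /= mulrDr IH IH'.
  + by rewrite -scalerAr !linearZ /= -scalerAr IH.
- by rewrite mulrDl !linearD /= mulrDl IH IH'.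
- by rewrite -scalerAl !linearZ /= -scalerAl IH.
Qed.

Lemma tens3_ind (U V W : lmodType K) (P : (U ⊗ (V ⊗ W))%type -> Prop) :
  P 0 -> (forall u v w, P (u ⊠ (v ⊠ w))) -> (forall s t, P s -> P t -> P (s + t)) ->
  (forall k t, P t -> P (k *: t)) -> forall t, P t.
Proof.
move=> P0 Pp PD PZ; apply: tens_ind => // u; apply: tens_ind => // [|s t|k t].
- by rewrite tpure0r.
- by rewrite tpureDr; apply: PD.
- by rewrite tpureZr; apply: PZ.
Qed.

Lemma comul3M : {morph comul3 q0 : g h / g * h}.
Proof.
by move=> g h; rewrite /comul3 /= rmorphM tmapM // => s t; rewrite rmorphM.
Qed.

Lemma comul3_x i j :
  comul3 q0 (xM q i j) = \sum_k \sum_l xM q i k ⊠ (xM q k l ⊠ xM q l j).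
Proof.
rewrite /comul3 /= comulM_x linear_sum; apply: eq_bigr => k _.
rewrite /= tmap_pure /= comulM_x -[LHS]/(tpure (xM q i k) _).
by rewrite !big_ord2 tpureDr.
Qed.

Lemma orbit1 p (pl : forall b, linear (p^~ b)) (pr : forall a, linear (p a)) :
  ev_id hxi (coact3 q0 pl pr (comul3 q0 1)) = p 1 1.
Proof.
have -> : comul3 q0 1 = 1 ⊠ (1 ⊠ 1).
  rewrite /comul3 /= rmorph1 -[X in tmap _ _ X]/(1 ⊠ 1) tmap_pure /=.
  by rewrite rmorph1.
rewrite coact3_pure /= tlift_pure !rmorph1 scale1r.
by rewrite /antipode rmorph1.
Qed.

Let beta_orbitE h : beta_orbit q0 hxi h =
  ev_id hxi (coact3 q0 (@mul_linearl K q) (@mul_linearr K q) (comul3 q0 h)).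
Proof. by []. Qed.

Let alpha_orbitE h : alpha_orbit q0 hxi h =
  ev_id hxi (coact3 q0 (p := fun a b => b * a) (@mul_linearr K q) (@mul_linearl K q)
    (comul3 q0 h)).
Proof. by []. Qed.

Lemma beta_orbit1 : beta_orbit q0 hxi 1 = 1.
Proof. by rewrite beta_orbitE orbit1 mulr1. Qed.

Lemma alpha_orbit1 : alpha_orbit q0 hxi 1 = 1.
Proof. by rewrite alpha_orbitE orbit1 mulr1. Qed.

(** The antipode reverses products, so a factor multiplied on the right wraps around the previous
    value from both sides. *)
Lemma ev_coact_mul t x y z :
  let psi s := ev_id hxi (coact3 q0 (@mul_linearl K q) (@mul_linearr K q) s) in
  psi (t * (x ⊠ (y ⊠ z))) =
  eval_at hxi y *: (antipode q0 (to_GLq q x) * psi t * to_GLq q z).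
Proof.
move=> psi; rewrite {}/psi; elim/tens3_ind: t => [|u v w|s t IHs IHt|c t IH].
- by rewrite mul0r !linear0 mulr0 mul0r scaler0.
- rewrite !tpureM !coact3_pure /= !tlift_pure !rmorphM /= antipodeM.
  by rewrite -!(scalerAl, scalerAr) scalerA mulrC !mulrA.
- by rewrite mulrDl !linearD mulrDr mulrDl scalerDr IHs IHt.
- by rewrite -scalerAl !linearZZ IH -scalerAr -scalerAl !scalerA [c * _]mulrC.
Qed.

Lemma ev_coact_mul_op t x y z :
  let psi s := ev_id hxi
    (coact3 q0 (p := fun a b => b * a) (@mul_linearr K q) (@mul_linearl K q) s) in
  psi (x ⊠ (y ⊠ z) * t) =
  eval_at hxi y *: (to_GLq q z * psi t * antipode q0 (to_GLq q x)).
Proof.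
move=> psi; rewrite {}/psi; elim/tens3_ind: t => [|u v w|s t IHs IHt|c t IH].
- by rewrite mulr0 !linear0 mulr0 mul0r scaler0.
- rewrite !tpureM !coact3_pure /= !tlift_pure !rmorphM /= antipodeM.
  by rewrite -!(scalerAl, scalerAr) scalerA !mulrA.
- by rewrite mulrDr !linearD mulrDr mulrDl scalerDr IHs IHt.
- by rewrite -scalerAr !linearZZ IH -scalerAr -scalerAl !scalerA [c * _]mulrC.
Qed.

Lemma beta_orbit_mulx g i j : beta_orbit q0 hxi (g * xM q i j) =
  \sum_k \sum_l xi k l *: (antipode q0 (xGL q i k) * beta_orbit q0 hxi g * xGL q l j).
Proof.
rewrite beta_orbitE comul3M comul3_x mulr_sumr !linear_sum; apply: eq_bigr => k _.
rewrite mulr_sumr !linear_sum; apply: eq_bigr => l _.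
by rewrite ev_coact_mul !Mq_liftE.
Qed.

Lemma alpha_orbit_mulx g i j : alpha_orbit q0 hxi (xM q i j * g) =
  \sum_k \sum_l xi k l *: (xGL q l j * alpha_orbit q0 hxi g * antipode q0 (xGL q i k)).
Proof.
rewrite alpha_orbitE comul3M comul3_x mulr_suml !linear_sum; apply: eq_bigr => k _.
rewrite mulr_suml !linear_sum; apply: eq_bigr => l _.
by rewrite ev_coact_mul_op !Mq_liftE.
Qed.

End OrbitMaps.
(* Exponents contributed by x_2j to a monomial in x_21 and x_22. *)
Definition ncol0 (j : 'I_2) : nat := j == 0.
Definition ncol1 (j : 'I_2) : nat := j == 1.

(** * Monomials in the bottom row and the inverse determinant *)

Section BottomRow.
Variables (K : fieldType) (q : K) (q0 : q != 0).
Let u := xGL q 1 0.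
Let v := xGL q 1 1.
Let d := dinv q.

Definition row_mono (m n k : nat) : GLq q := u ^+ m * v ^+ n * d ^+ k.

Lemma xGL_dinv i j : xGL q i j * d = d * xGL q i j.
Proof. exact: qdetV_comm q0 _ _ _ (xGL_qmx q) (detqV q) (detVq q) i j. Qed.

Let vu : prop_to (v * u) (u * v).
Proof. by apply: prop_to_sym; rewrite (qmx_21_22 (xGL_qmx q)); apply: prop_toZ. Qed.

Let mul_u m n k : u * row_mono m n k = row_mono m.+1 n k.
Proof. by rewrite /row_mono !mulrA -exprS. Qed.

Let mul_v m n k : prop_to (v * row_mono m n k) (row_mono m n.+1 k).
Proof.
rewrite /row_mono !mulrA exprS [u ^+ m * _]mulrA; do 2!apply: prop_toMr.
exact/prop_to_sym/prop_toC_exp/prop_to_sym.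
Qed.

Let mono_mul_d m n k : row_mono m n k * d = row_mono m n k.+1.
Proof. by rewrite /row_mono -mulrA -exprSr. Qed.

Let mono_mul_v m n k : row_mono m n k * v = row_mono m n.+1 k.
Proof.
have cvd : GRing.comm v d := xGL_dinv 1 1.
by rewrite /row_mono -mulrA -(commrX _ cvd) mulrA -[_ * _ * v]mulrA -exprSr.
Qed.

Let mono_mul_u m n k : prop_to (row_mono m n k * u) (row_mono m.+1 n k).
Proof.
have cud : GRing.comm u d := xGL_dinv 1 0.
rewrite /row_mono -mulrA -(commrX _ cud) mulrA; apply: prop_toMr.
by rewrite exprSr -!mulrA; apply/prop_toMl/prop_toC_exp.
Qed.

Lemma d_mul_mono m n k : d * row_mono m n k = row_mono m n k.+1.
Proof.
have cd x : GRing.comm d x -> forall m, GRing.comm d (x ^+ m) by move=> ? ?; apply: commrX.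
have /cd cu : GRing.comm d u := esym (xGL_dinv 1 0).
have /cd cv : GRing.comm d v := esym (xGL_dinv 1 1).
by rewrite /row_mono exprS !mulrA cu -[u ^+ m * d * _]mulrA cv !mulrA.
Qed.

(** The shape of the beta recursion: the antipode of a first-column entry is a nonzero multiple of a
    bottom-row entry times [d]. *)
Lemma sandwich_l i j m n k :
  prop_to (xGL q 1 i * d * row_mono m n k * xGL q 1 j)
    (row_mono (m + ncol0 i + ncol0 j)%N (n + ncol1 i + ncol1 j)%N k.+1).
Proof.
rewrite -mulrA -mulrA -!/d [d * _]mulrA d_mul_mono mulrA.
have h : prop_to (xGL q 1 i * row_mono m n k.+1)
    (row_mono (m + ncol0 i)%N (n + ncol1 i)%N k.+1).
  by move: i; apply: forall_ord2; rewrite /= ?addn0 ?addn1 ?mul_u //;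
    apply: prop_to_refl.
apply: prop_to_trans (prop_toMr _ h) _; move: (m + _)%N (n + _)%N => m' n'.
by move: j; apply: forall_ord2; rewrite /= ?addn0 ?addn1 ?mono_mul_v //;
  apply: prop_to_refl.
Qed.

Lemma sandwich_r i j m n k :
  prop_to (xGL q 1 j * row_mono m n k * (xGL q 1 i * d))
    (row_mono (m + ncol0 i + ncol0 j)%N (n + ncol1 i + ncol1 j)%N k.+1).
Proof.
rewrite (xGL_dinv 1 i) mulrA -[_ * _ * dinv q]mulrA mono_mul_d -mulrA.
have h : prop_to (row_mono m n k.+1 * xGL q 1 i)
    (row_mono (m + ncol0 i)%N (n + ncol1 i)%N k.+1).
  by move: i; apply: forall_ord2; rewrite /= ?addn0 ?addn1 ?mono_mul_v //;
    apply: prop_to_refl.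
apply: prop_to_trans (prop_toMl _ h) _; move: (m + _)%N (n + _)%N => m' n'.
by move: j; apply: forall_ord2; rewrite /= ?addn0 ?addn1 ?mul_u //;
  apply: prop_to_refl.
Qed.

Lemma mono_mul_quad i j m n k :
  prop_to (row_mono m n k * (xGL q 1 i * xGL q 1 j * d))
    (row_mono (m + ncol0 i + ncol0 j)%N (n + ncol1 i + ncol1 j)%N k.+1).
Proof.
rewrite !mulrA -mono_mul_d; apply: prop_toMr.
have h m' n' l : prop_to (row_mono m' n' k * xGL q 1 l)
    (row_mono (m' + ncol0 l)%N (n' + ncol1 l)%N k).
  by move: l; apply: forall_ord2; rewrite /= ?addn0 ?addn1 ?mono_mul_v //;
    apply: prop_to_refl.
exact: prop_to_trans (prop_toMr _ (h _ _ _)) (h _ _ _).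
Qed.

(** Since the determinant is quadratic, these have total degree 0 when [p.1 + p.2] is even, as it is
    for every value of [pm_exp]. *)
Definition bal_mono (p : nat * nat) : GLq q := row_mono p.1 p.2 (p.1 + p.2)./2.

Definition bal_gens : set (GLq q) := [set u ^+ 2 * d; u * v * d; v ^+ 2 * d].

(** The injective sequence [r] expresses that [K] is infinite. *)
Lemma poly0_of_inj_roots (r : nat -> K) (p : {poly K}) :
  injective r -> (forall n, root p (r n)) -> p = 0.
Proof.
move=> inj_r rp; apply/eqP; case: (eqVneq p 0) => // p0.
have := max_poly_roots p0 (rs := [seq r n | n <- iota 0 (size p)]).
rewrite size_map size_iota ltnn => -> //; first by apply/allP => _ /mapP[n _ ->].
by rewrite map_inj_uniq ?iota_uniq.
Qed.

(** * Shift and clock matrices as a representation of the quantum group *)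

Section ShiftRepresentation.
Variables (N : nat) (lam : K) (lam0 : lam != 0).
Let M : algType K := 'M[K]_N.+1.

Let shift : M := \matrix_(i, j) (lam *+ (j == i.+1 :> nat)).
Let clock : M := diag_mx (\row_i (lam * q ^+ i)).
Let clockV : M := diag_mx (\row_i (lam * q ^+ i)^-1).

(** Lower triangular with inverse diagonal entries, so that the quantum determinant is 1. The scalar
    [lam] enters both bottom-row entries once and thus records the total degree. *)
Definition shift_mx (i j : 'I_2) : M :=
  if i == 0 then if j == 0 then clockV else 0 else if j == 0 then shift else clock.

Let clockVK : clockV * clock = 1.
Proof.
rewrite -[LHS]/(_ *m _) mul_diag_mx; apply/matrixP => i j.
rewrite !mxE; case: (i == j); rewrite ?mulr0n ?mulr0 // !mulr1n mulVf //.
by rewrite mulf_neq0 // expf_neq0.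
Qed.
Let clockKV : clock * clockV = 1.
Proof.
rewrite -[LHS]/(_ *m _) mul_diag_mx; apply/matrixP => i j.
rewrite !mxE; case: (i == j); rewrite ?mulr0n ?mulr0 // !mulr1n mulfV //.
by rewrite mulf_neq0 // expf_neq0.
Qed.
Let shift_clock : shift * clock = q *: (clock * shift).
Proof.
rewrite -[shift * _]/(_ *m _) -[clock * _]/(_ *m _) mul_diag_mx mul_mx_diag.
apply/matrixP => i j; rewrite !mxE.
case: (eqVneq (j : nat) i.+1) => [->|_]; last by rewrite !mulr0n !(mul0r, mulr0).
by rewrite exprS; ring.
Qed.

Lemma shift_qmx : is_qmx q shift_mx.
Proof.
split; rewrite /shift_mx /= ?(mulr0, mul0r, scaler0) //.
(* Conjugating [shift_clock] by [clockV] gives the commutation of [clockV] with [shift]. *)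
- rewrite -[clockV * shift]mulr1 -clockKV -!mulrA [shift * (_ * _)]mulrA shift_clock.
  by rewrite -!scalerAl -scalerAr -!mulrA [clockV * (clock * _)]mulrA clockVK mul1r.
- by rewrite clockVK clockKV subrr.
Qed.

Lemma shift_qdet : qdet q shift_mx = 1.
Proof. by rewrite /qdet /shift_mx /= mul0r scaler0 subr0. Qed.

Definition shift_rep : {lrmorphism GLq q -> M} :=
  GLq_lift shift_qmx (etrans (mulr1 _) shift_qdet) (etrans (mul1r _) shift_qdet).

(** For [m] larger than [N] no [j] equals [m] and both sides vanish, in accordance with
    nilpotency. *)
Let shiftX m (j : 'I_N.+1) : (shift ^+ m) 0 j = lam ^+ m *+ (j == m :> nat).
Proof.
elim: m j => [|m IH] j.
  by rewrite !expr0 -[1]/(1%:M : 'M_N.+1) mxE eq_sym.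
rewrite exprSr -[_ * _]/(_ *m _) mxE.
case: eqP => [jm|jm]; last first.
  apply: big1 => k _; rewrite IH mxE.
  case: eqP => [->|_]; last by rewrite mulr0n mul0r.
  by case: eqP => [//|_]; rewrite mulr0n mulr0.
have lt_m : (m < N.+1)%N by apply: ltnW; rewrite -jm ltn_ord.
rewrite (bigD1 (Ordinal lt_m)) //= IH mxE /= jm !eqxx !mulr1n -exprSr.
rewrite big1 ?addr0 // => k /eqP nk; rewrite IH; case: eqP => [e|_].
  by case: nk; apply: val_inj.
by rewrite mulr0n mul0r.
Qed.

Let clockX n : clock ^+ n = diag_mx (\row_i (lam * q ^+ i) ^+ n).
Proof.
elim: n => [|n IH].
  by apply/matrixP => i j; rewrite expr0 -[1]/(1%:M : 'M_N.+1) !mxE expr0.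
rewrite exprSr IH -[_ * _]/(_ *m _) mul_diag_mx; apply/matrixP => i j; rewrite !mxE.
by case: (i == j); rewrite ?mulr0n ?mulr0 // !mulr1n -exprSr.
Qed.

Lemma shift_rep_mono m n k (j : 'I_N.+1) :
  shift_rep (row_mono m n k) 0 j = (lam ^+ (m + n) * q ^+ (m * n)) *+ (j == m :> nat).
Proof.
rewrite /row_mono !rmorphM !rmorphXn /= !GLq_liftE GLq_lift_dinv expr1n mulr1.
rewrite -[shift_mx 1 0]/shift -[shift_mx 1 1]/clock clockX.
rewrite -[_ * _]/(_ *m _) mul_mx_diag !mxE shiftX.
case: eqP => [->|_]; last by rewrite !mulr0n mul0r.
by rewrite !mulr1n exprMn mulrA -exprD exprM.
Qed.

End ShiftRepresentation.

(** In size [m.+1], the last entry of the first row selects the monomials with exponent [m] of [u].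
    It is a polynomial in [lam] whose degrees separate the exponents of [v]. As [d] acts by 1, the
    exponents [k] may be arbitrary. *)
Lemma row_mono_free (k : nat * nat -> nat) (r : nat -> K) : injective r ->
  lin_free (fun p : nat * nat => row_mono p.1 p.2 (k p)).
Proof.
move=> inj_r s s0 [m n].
pose P : {poly K} := \sum_(p <- s)
  (p.1 * q ^+ (p.2.1 * p.2.2) *+ (m == p.2.1)) *: 'X^(p.2.1 + p.2.2).
(* The representation needs a nonzero [lam]; the factor ['X] takes care of a possible value 0 of
   [r]. *)
have P0 : P * 'X = 0.
  apply: (poly0_of_inj_roots inj_r) => i; rewrite rootM rootX orbC.
  have [//|lam0 /=] := eqVneq (r i) 0.
  have := congr1 (fun g => shift_rep m lam0 g 0 ord_max) s0.
  rewrite linear_sum linear0 summxE !mxE => Pr; rewrite /root /P horner_sum -[X in _ == X]Pr.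
  apply/eqP/eq_bigr => p _; rewrite linearZ hornerZ hornerXn /= [RHS]mxE.
  rewrite shift_rep_mono /=; case: eqP => _; rewrite ?mulr0n ?mul0r ?mulr0 // !mulr1n.
  by ring.
have {P0}/(congr1 (fun p : {poly K} => p`_(m + n))) : P = 0.
  by move/eqP: P0; rewrite mulf_eq0 polyX_eq0 orbF => /eqP.
rewrite coef_sum coef0 => Pmn.
(* The coefficient of degree [m + n] in [P] is the wanted sum times this power of [q]. *)
have qmn : q ^+ (m * n) != 0 by rewrite expf_neq0.
apply: (mulIf qmn); rewrite mul0r -[RHS]Pmn mulr_suml big_mkcond.
apply: eq_bigr => -[c [m' n']] _ /=; rewrite coefZ coefXn xpair_eqE.
rewrite [m == m']eq_sym; case: eqP => [->|_] /=; last by rewrite mulr0n mul0r.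
by rewrite eqn_add2l eq_sym; case: eqP => [->|_]; rewrite mulr1n ?mulr1 ?mulr0.
Qed.

Let half_step i j m n :
  ((m + ncol0 i + ncol0 j + (n + ncol1 i + ncol1 j))./2 = (m + n)./2.+1)%N.
Proof.
by move: i j; apply: forall_ord2; apply: forall_ord2; rewrite /= ?addn0 ?addn1 ?addnS ?addSn.
Qed.

Lemma bal_mono_mul i j m n :
  prop_to (bal_mono (m, n) * (xGL q 1 i * xGL q 1 j * d))
    (bal_mono (m + ncol0 i + ncol0 j, n + ncol1 i + ncol1 j)%N).
Proof. by rewrite /bal_mono /= half_step; apply: mono_mul_quad. Qed.

Lemma bal_sandwich_l i j m n :
  prop_to (xGL q 1 i * d * bal_mono (m, n) * xGL q 1 j)
    (bal_mono (m + ncol0 i + ncol0 j, n + ncol1 i + ncol1 j)%N).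
Proof. by rewrite /bal_mono /= half_step; apply: sandwich_l. Qed.

Lemma bal_sandwich_r i j m n :
  prop_to (xGL q 1 j * bal_mono (m, n) * (xGL q 1 i * d))
    (bal_mono (m + ncol0 i + ncol0 j, n + ncol1 i + ncol1 j)%N).
Proof. by rewrite /bal_mono /= half_step; apply: sandwich_r. Qed.

Lemma bal_mono_free (r : nat -> K) : injective r -> lin_free bal_mono.
Proof. exact: row_mono_free (fun p => (p.1 + p.2)./2) r. Qed.

End BottomRow.

Arguments bal_gens [K] q _.

(** * Generated subalgebras, right ideals and right coideals *)

Section Subalgebras.
Variables (K : fieldType) (A : algType K).

Lemma is_subalgebraP (B : set A) : is_subalgebra B <->
  [/\ B 1, forall k x y, B x -> B y -> B (k *: x + y) & forall x y, B x -> B y -> B (x * y)].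
Proof.
split=> -[B1 BL BM]; split.
- by move: B1; rewrite inE.
- by move=> k x y; have := BL k x y; rewrite !inE.
- by move=> x y; have := BM x y; rewrite !inE.
- by rewrite inE.
- by move=> k x y; rewrite !inE; apply: BL.
- by move=> x y; rewrite !inE; apply: BM.
Qed.

Lemma subalgebra_gen_sub (G : set A) : is_subalgebra (subalgebra_gen G).
Proof.
apply/is_subalgebraP; split=> [|k x y Bx By|x y Bx By] C [/[dup] /is_subalgebraP[C1 CL CM] hC GC] //.
  by apply: CL; [apply: Bx|apply: By].
by apply: CM; [apply: Bx|apply: By].
Qed.

Lemma subalgebra_gen_incl (G : set A) : G `<=` subalgebra_gen G.
Proof. by move=> g Gg C [_]; apply. Qed.

Lemma subalgebra_gen_min (G B : set A) : is_subalgebra B -> G `<=` B -> subalgebra_gen G `<=` B.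
Proof. by move=> hB GB x; apply. Qed.

Lemma right_ideal_gen_pair (s t : A) :
  right_ideal_gen [set s; t] = [set h | exists g g', h = s * g + t * g'].
Proof.
apply/seteqP; split=> [h|_ [g [g' ->]] I [[I0 ID IM] sI]]; last first.
  by apply: ID; apply: IM; apply: sI; [left|right].
apply; split; first split.
- by exists 0, 0; rewrite !mulr0 addr0.
- move=> _ _ [g [g' ->]] [h1 [h2 ->]]; exists (g + h1), (g' + h2).
  by rewrite !mulrDr addrACA.
- by move=> _ b [g [g' ->]]; exists (g * b), (g' * b); rewrite mulrDl !mulrA.
- move=> _ [->|->]; first by exists 1, 0; rewrite mulr1 mulr0 addr0.
  by exists 0, 1; rewrite mulr1 mulr0 add0r.
Qed.

Lemma tens_left_pure (B : set A) b a : B b -> tens_left B (b ⊠ a).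
Proof. by move=> Bb C [_]; apply; exists b => //; exists a. Qed.

Let submodP (V : lmodType K) (W : set V) : GRing.submod_closed [in W] <->
  W 0 /\ forall k x y, W x -> W y -> W (k *: x + y).
Proof.
split=> -[W0 WL]; split.
- by move: W0; rewrite inE.
- by move=> k x y; have := WL k x y; rewrite !inE.
- by rewrite inE.
- by move=> k x y; rewrite !inE; apply: WL.
Qed.

Lemma tens_left_submod (B : set A) :
  tens_left B 0 /\ forall k s t, tens_left B s -> tens_left B t -> tens_left B (k *: s + t).
Proof.
split=> [|k s t Bs Bt] C [/[dup] /submodP[C0 CL] hC BC] //.
by apply: CL; [apply: Bs|apply: Bt].
Qed.

Lemma tens_left_min (B : set A) (P : (A ⊗ A)%type -> Prop) :
  P 0 -> (forall k s t, P s -> P t -> P (k *: s + t)) -> (forall b a, B b -> P (b ⊠ a)) ->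
  forall t, tens_left B t -> P t.
Proof.
move=> P0 PL Pp t; apply; split; first exact/submodP.
by move=> _ [b Bb [a _ <-]]; apply: Pp.
Qed.

Lemma tens_left_subalgebra (B : set A) s t :
  is_subalgebra B -> tens_left B s -> tens_left B t -> tens_left B (s * t).
Proof.
move=> /is_subalgebraP[_ _ BM] Bs Bt; have [L0 LL] := tens_left_submod B.
move: s Bs; apply: tens_left_min => [|k s s' IH IH'|b a Bb].
- by rewrite mul0r.
- by rewrite mulrDl -scalerAl; apply: LL.
- move: t Bt; apply: tens_left_min => [|k t t' IH IH'|b' a' Bb'].
  + by rewrite mulr0.
  + by rewrite mulrDr -scalerAr; apply: LL.
  + by rewrite tpureM; apply: tens_left_pure; apply: BM.
Qed.

(** The elements that [D] sends into [tens_left] of the generated subalgebra form a subalgebra, so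
    the generators suffice. *)
Lemma right_coideal_gen (D : {lrmorphism A -> (A ⊗ A)%type}) (G : set A) :
  D @` G `<=` tens_left (subalgebra_gen G) ->
  is_right_coideal_subalgebra D (subalgebra_gen G).
Proof.
move=> DG; have hB := subalgebra_gen_sub G; split=> // _ [b Bb <-].
have [L0 LL] := tens_left_submod (subalgebra_gen G).
have /is_subalgebraP[B1 _ _] := hB.
move: b Bb; apply: (@subalgebra_gen_min _ [set b | tens_left (subalgebra_gen G) (D b)]).
  apply/is_subalgebraP; split=> /= [|k x y|x y].
  - by rewrite rmorph1; apply: tens_left_pure.
  - by rewrite linearP; apply: LL.
  - by rewrite rmorphM; apply: tens_left_subalgebra.
by move=> g Gg; apply: DG; exists g.
Qed.

End Subalgebras.

(** * The two co-orbit maps at the nilpotent matrix *)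

Section NilpotentCase.
Variables (K : fieldType) (q : K) (q0 : q != 0).
Let u := xGL q 1 0.
Let v := xGL q 1 1.
Let d := dinv q.

Lemma presented_generates (P : presentation K) (Q : presented P -> Prop) :
  (forall k : K, Q k%:A) -> (forall x, Q (pX x)) ->
  (forall g h, Q g -> Q h -> Q (g + h)) -> (forall g h, Q g -> Q h -> Q (g * h)) ->
  forall h, Q h.
Proof.
move=> Qk Qx QD QM h; rewrite -[h]preprK -teval_pX.
by elim: (prepr h) => [k|x|s IHs t IHt|s IHs t IHt] /=; auto.
Qed.

Lemma xM_generates : generates (xM q).
Proof. by move=> P Pk Px PD PM; apply: presented_generates => // -[i j]; apply: Px. Qed.

Lemma xM_generates_op : generates (xM q : 'I_2 -> 'I_2 -> (Mq q)^c).
Proof.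
by move=> P Pk Px PD PM; apply: xM_generates => // g h Pg Ph; apply: PM h g Ph Pg.
Qed.

Lemma is_qmx_converse (A : algType K) (x : 'I_2 -> 'I_2 -> A) :
  is_qmx q x -> is_qmx q^-1 (x : 'I_2 -> 'I_2 -> A^c).
Proof.
case=> h1 h2 h3 h4 h5 h6.
have inv (y z : A) : y = q *: z -> z = q^-1 *: y by move=> ->; rewrite scalerA mulVf ?scale1r.
apply: is_qmx_op => //; do ?[exact: inv].
by rewrite invrK -opprB h6 -scaleNr opprB h5.
Qed.

(** The last relation exchanges the diagonal entries, turning the factor [q] of the determinant into
    [q^-1]. *)
Lemma qdet_converse (A : algType K) (x : 'I_2 -> 'I_2 -> A) :
  is_qmx q x -> qdet q^-1 (x : 'I_2 -> 'I_2 -> A^c) = qdet q x.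
Proof.
case=> _ _ _ _ h5 h6.
change (x 1 1 * x 0 0 - q^-1 *: (x 1 0 * x 0 1) = qdet q x).
have -> : x 1 1 * x 0 0 = x 0 0 * x 1 1 - (q - q^-1) *: (x 0 1 * x 1 0).
  by rewrite -h6 opprB addrC subrK.
by rewrite /qdet -h5; mlinear K A; ring.
Qed.

Lemma lin_span_bal : lin_span (bal_mono q \o pm_exp) = subalgebra_gen (bal_gens q).
Proof.
have B_alg := subalgebra_gen_sub (bal_gens q).
set B := subalgebra_gen _ in B_alg *; have /is_subalgebraP[B1 BL BM] := B_alg.
have B0 : B 0 by rewrite -(addNr 1) -scaleN1r; apply: BL.
have BZ k x : B x -> B (k *: x) by move=> Bx; rewrite -[_ *: _]addr0; apply: BL.
have gen00 : bal_gens q (u * u * d) by left; left.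
have gen01 : bal_gens q (u * v * d) by left; right.
have gen11 : bal_gens q (v * v * d) by right.
have gB := @subalgebra_gen_incl _ _ (bal_gens q).
have Bstep i j m n : B (xGL q 1 i * xGL q 1 j * d) -> B (bal_mono q (m, n)) ->
    B (bal_mono q (m + ncol0 i + ncol0 j, n + ncol1 i + ncol1 j)%N).
  move=> Bij Bmn; have [k k0 ->] := prop_to_sym (bal_mono_mul q0 i j m n).
  by apply: BZ; apply: BM.
apply/seteqP; split=> x.
  apply: lin_span_min => // [y z By Bz|k [[e i] j]].
    by rewrite -[y]scale1r; apply: BL.
  apply: BZ; rewrite /= /pm_exp /=.
  elim: j => [|j IH]; last by rewrite doubleS !addnS; have := Bstep 0 0 _ _ (gB _ gen00) IH;
    rewrite /= !addn1 !addn0.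
  elim: i => [|i IH]; last by rewrite doubleS !addnS; have := Bstep 1 1 _ _ (gB _ gen11) IH;
    rewrite /= !addn1 !addn0.
  have Be0 : B (bal_mono q (0, 0)%N) by rewrite /bal_mono /row_mono !mulr1.
  by case: e => //; apply: (Bstep 0 1 0%N 0%N (gB _ gen01)).
set S := lin_span _.
have S1 : S 1.
  have := lin_span_gen (bal_mono q \o pm_exp) (false, 0, 0)%N.
  by rewrite /= /bal_mono /row_mono !mulr1.
(* The elements whose right multiplication preserves the span form a subalgebra, so only the three
   generators have to be tested. *)
suff BS : B `<=` [set b | forall w, S w -> S (w * b)].
  by move=> Bx; rewrite -[x]mul1r; apply: BS.
apply: subalgebra_gen_min => [|b Gb w].
  apply/is_subalgebraP; split=> /= [w|k y z Sy Sz w Sw|y z Sy Sz w Sw].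
  - by rewrite mulr1.
  - rewrite mulrDr -scalerAr.
    by apply: lin_spanD; [apply/lin_spanZ/Sy|apply: Sz].
  - by rewrite mulrA; apply/Sz/Sy.
move: w; apply: lin_span_min => [|y z Sy Sz|k [[e i] j]].
- by rewrite mul0r; apply: lin_span0.
- by rewrite mulrDl; apply: lin_spanD.
rewrite -scalerAl; apply: lin_spanZ.
have Sprop t y : prop_to y (bal_mono q (pm_exp t)) -> S y.
  by case=> l _ ->; apply/lin_spanZ/(lin_span_gen (bal_mono q \o pm_exp)).
have step i' j' t : (bal_mono q (pm_exp t)) = bal_mono q
     ((pm_exp (e, i, j)).1 + ncol0 i' + ncol0 j', (pm_exp (e, i, j)).2 + ncol1 i' + ncol1 j')%N ->
    S ((bal_mono q \o pm_exp) (e, i, j) * (xGL q 1 i' * xGL q 1 j' * d)).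
  by move=> e_t; apply: (Sprop t); rewrite e_t; apply: bal_mono_mul.
case: Gb => [[->|->]|->].
- apply: (step 0 0 (e, i, j.+1)).
  by rewrite /pm_exp /= doubleS !addn0 !addn1 !addnS.
(* A second mixed factor [u * v] completes both squares: [e] falls back to 0 while [i] and [j] grow
   by one. *)
- case: e step => step.
    by apply: (step 0 1 (false, i.+1, j.+1)); rewrite /pm_exp /= !doubleS !addn0 !addn1.
  by apply: (step 0 1 (true, i, j)); rewrite /pm_exp /= !addn0 !addn1.
- apply: (step 1 1 (e, i.+1, j)).
  by rewrite /pm_exp /= doubleS !addn0 !addn1 !addnS.
Qed.

(** As [d] is group-like and row 1 is comultiplied along itself, the left legs are again products of
    two bottom-row entries with [d]. *)
Lemma bal_gens_coideal :
  is_right_coideal_subalgebra (comulGL q0) (subalgebra_gen (bal_gens q)).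
Proof.
apply: right_coideal_gen => _ [b Gb <-].
set B := subalgebra_gen _.
have [L0 LL] := tens_left_submod B.
have LZ k t : tens_left B t -> tens_left B (k *: t).
  by move=> Lt; rewrite -[_ *: _]addr0; apply: LL.
have LD s t : tens_left B s -> tens_left B t -> tens_left B (s + t).
  by move=> Ls Lt; rewrite -[s]scale1r; apply: LL.
have quad i j : tens_left B (comulGL q0 (xGL q 1 i * xGL q 1 j * d)).
  rewrite !rmorphM /= !comulGL_x comulGL_dinv !big_ord2.
  rewrite !(mulrDl, mulrDr) !tpureM.
  have gB k l : B (xGL q 1 k * xGL q 1 l * d).
    have gB := @subalgebra_gen_incl _ _ (bal_gens q).
    have Buv : B (u * v * d) by apply: gB; left; right.
    move: k l; apply: forall_ord2; apply: forall_ord2 => //.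
    - by apply: gB; left; left.
    - have -> : xGL q 1 1 * xGL q 1 0 = q^-1 *: (u * v).
        by rewrite /u /v (qmx_21_22 (xGL_qmx q)) scalerA mulVf // scale1r.
      have /is_subalgebraP[B1 BL _] := subalgebra_gen_sub (bal_gens q).
      have B0 : B 0 by rewrite -(addNr 1) -scaleN1r; apply: BL.
      by rewrite -scalerAl -[_ *: _]addr0; apply: BL.
    - by apply: gB; right.
  by do !apply: (LD); apply: tens_left_pure; apply: gB.
by case: Gb => [[->|->]|->]; apply: quad.
Qed.

Variable xi1 : K.
Hypothesis xi1_neq0 : xi1 != 0.
Variable r : nat -> K.
Hypothesis inj_r : injective r.

Let beta := beta_orbit q0 (nilp_qmx q xi1).
Let alpha := alpha_orbit q0 (nilp_qmx q xi1).

Let sum_nilp (V : lmodType K) (F : 'I_2 -> 'I_2 -> V) :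
  \sum_k \sum_l nilp_mx xi1 k l *: F k l = xi1 *: F 0 1.
Proof. by rewrite !big_ord2 !mxE /= !mulr0 mulr1 !scale0r !addr0 add0r. Qed.

Let beta_op (i j : 'I_2) (w : GLq q) := xi1 *: (antipode q0 (xGL q i 0) * w * xGL q 1 j).
Let alpha_op (i j : 'I_2) (w : GLq q) := xi1 *: (xGL q 1 j * w * antipode q0 (xGL q i 0)).

Let beta_mulx g i j : beta (g * xM q i j) = beta_op i j (beta g).
Proof. by rewrite /beta beta_orbit_mulx sum_nilp. Qed.

Let alpha_mulx g i j : alpha (xM q i j * g) = alpha_op i j (alpha g).
Proof. by rewrite /alpha alpha_orbit_mulx sum_nilp. Qed.

Let beta_x i j : beta (xM q i j) = beta_op i j 1.
Proof. by rewrite -[xM q i j]mul1r beta_mulx [beta 1]beta_orbit1. Qed.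

Let alpha_x i j : alpha (xM q i j) = alpha_op i j 1.
Proof. by rewrite -[xM q i j]mulr1 alpha_mulx [alpha 1]alpha_orbit1. Qed.

Let beta_opZ i j k w : beta_op i j (k *: w) = k *: beta_op i j w.
Proof. by rewrite /beta_op -scalerAr -scalerAl !scalerA mulrC. Qed.

Let alpha_opZ i j k w : alpha_op i j (k *: w) = k *: alpha_op i j w.
Proof. by rewrite /alpha_op -scalerAr -scalerAl !scalerA mulrC. Qed.

(** In ['I_2] the index [1 - i] is the other one. *)
Let antipode_col0 i : prop_to (antipode q0 (xGL q i 0)) (xGL q 1 (1 - i) * d).
Proof.
rewrite antipode_x; move: i; apply: forall_ord2; rewrite /antipode_mx /= ?subr0 ?subrr.
  exact: prop_to_refl.
by apply: prop_toZ; rewrite oppr_eq0.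
Qed.

Let beta_op_bal i j m n : prop_to (beta_op i j (bal_mono q (m, n)))
  (bal_mono q (m + ncol0 (1 - i)%R + ncol0 j, n + ncol1 (1 - i)%R + ncol1 j)%N).
Proof.
apply: prop_to_trans (prop_toZ _ xi1_neq0) _.
apply: prop_to_trans (bal_sandwich_l q0 _ _ _ _).
by do 2!apply: prop_toMr.
Qed.

Let alpha_op_bal i j m n : prop_to (alpha_op i j (bal_mono q (m, n)))
  (bal_mono q (m + ncol0 (1 - i)%R + ncol0 j, n + ncol1 (1 - i)%R + ncol1 j)%N).
Proof.
apply: prop_to_trans (prop_toZ _ xi1_neq0) _.
apply: prop_to_trans (bal_sandwich_r q0 _ _ _ _).
exact: prop_toMl.
Qed.

Let uv : u * v = q *: (v * u) := qmx_21_22 (xGL_qmx q).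

Let antipode0 : antipode q0 (xGL q 0 0) = v * d.
Proof. by rewrite antipode_x. Qed.

Let antipode1 : antipode q0 (xGL q 1 0) = (- q) *: (u * d).
Proof. by rewrite antipode_x. Qed.

Let bal00 : bal_mono q (0, 0)%N = 1.
Proof. by rewrite /bal_mono /row_mono !mulr1. Qed.

(** The two images are multiples of [v * u * d] and [u * v * d]. One factor [q] comes from the
    antipode and one from reordering, whence [q ^- 2]. *)
Let beta_tau : beta (xM q 0 0 + q ^- 2 *: xM q 1 1) = 0.
Proof.
rewrite linearD linearZZ !beta_x /beta_op antipode0 antipode1 !mulr1.
rewrite -/u -/v -!scalerAl -!mulrA -(xGL_dinv q0 1 0) -(xGL_dinv q0 1 1) -/u -/v.
rewrite [u * (v * d)]mulrA uv -scalerAl mulrA.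
by mlinear K (GLq q); field.
Qed.

Let alpha_tau : alpha (xM q 0 0 + xM q 1 1) = 0.
Proof.
rewrite linearD !alpha_x /alpha_op antipode0 antipode1 !mulr1.
rewrite -/u -/v -scalerAr !mulrA uv -scalerAl.
by mlinear K (GLq q); ring.
Qed.

(** Both products share the left factor [u * d * v * d], up to a common scalar, and what remains is
    [u * v - q *: (v * u)], which is 0. *)
Let beta_det : beta (qdet q (xM q)) = 0.
Proof.
rewrite /qdet linearB linearZZ !beta_mulx !beta_x /beta_op -?scalerAl -?scalerAr !mulr1 -?scalerAl.
rewrite -!mulrA -/u -/v uv -!scalerAr.
by mlinear K (GLq q); ring.
Qed.

Let alpha_det : alpha (qdet q (xM q)) = 0.
Proof.
rewrite -(qdet_converse (xM_qmx q)).
change (alpha (xM q 1 1 * xM q 0 0 - q^-1 *: (xM q 1 0 * xM q 0 1)) = 0).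
rewrite linearB linearZZ !alpha_mulx !alpha_x /alpha_op -?scalerAl -?scalerAr !mulr1 -?scalerAl.
rewrite !mulrA -/u -/v uv -!scalerAl.
by mlinear K (GLq q); field.
Qed.

Let unit00 : prop_to (1 : GLq q) (bal_mono q (0, 0)%N).
Proof. by rewrite bal00; apply: prop_to_refl. Qed.

Let beta_op00 : prop_to (beta_op 0 0 (bal_mono q (0, 0)%N)) (bal_mono q (1, 1)%N).
Proof. by have := beta_op_bal 0 0 0 0; rewrite subr0. Qed.
Let beta_op01 m n : prop_to (beta_op 0 1 (bal_mono q (m, n))) (bal_mono q (m, n.+2)).
Proof. by have := beta_op_bal 0 1 m n; rewrite subr0 /= !addn0 !addn1. Qed.
Let beta_op10 m n : prop_to (beta_op 1 0 (bal_mono q (m, n))) (bal_mono q (m.+2, n)).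
Proof. by have := beta_op_bal 1 0 m n; rewrite subrr /= !addn0 !addn1. Qed.

Let alpha_op00 : prop_to (alpha_op 0 0 (bal_mono q (0, 0)%N)) (bal_mono q (1, 1)%N).
Proof. by have := alpha_op_bal 0 0 0 0; rewrite subr0. Qed.
Let alpha_op01 m n : prop_to (alpha_op 0 1 (bal_mono q (m, n))) (bal_mono q (m, n.+2)).
Proof. by have := alpha_op_bal 0 1 m n; rewrite subr0 /= !addn0 !addn1. Qed.
Let alpha_op10 m n : prop_to (alpha_op 1 0 (bal_mono q (m, n))) (bal_mono q (m.+2, n)).
Proof. by have := alpha_op_bal 1 0 m n; rewrite subrr /= !addn0 !addn1. Qed.

Let qX2 : q ^- 2 != 0. Proof. by rewrite invr_eq0 expf_neq0. Qed.

Let beta1 : prop_to (beta 1) (bal_mono q (0, 0)%N).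
Proof. by rewrite [beta 1]beta_orbit1. Qed.

Lemma beta_nilp_range : range beta = subalgebra_gen (bal_gens q).
Proof.
rewrite -lin_span_bal.
exact: (nilpotent_orbit_range q0 qX2 (xM_qmx q) xM_generates beta_mulx beta_opZ
  beta_tau beta_det beta1 beta_op00 beta_op01 beta_op10).
Qed.

Lemma beta_nilp_ker : [set h | beta h = 0] = right_ideal_gen [set tau1 q; tau2 q].
Proof.
have tauE : tau1 q = q ^- 2 *: (xM q 0 0 + q ^- 2 *: xM q 1 1).
  by rewrite scalerDr scalerA -invfM -exprD.
rewrite right_ideal_gen_pair; apply/seteqP.
have kerP := nilpotent_orbit_ker q0 qX2 (xM_qmx q) xM_generates beta_mulx beta_opZ
  beta_tau beta_det beta1 beta_op00 beta_op01 beta_op10 (bal_mono_free q0 inj_r).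
split=> h /=.
  case/kerP => g [g' ->]; exists (q ^+ 2 *: g), (q ^+ 6 *: g').
  by rewrite tauE /tau2 -!scalerAl -!scalerAr !scalerA !mulVf ?expf_neq0 // !scale1r.
case=> g [g' ->]; apply/kerP; exists (q ^- 2 *: g), (q ^- 6 *: g').
by rewrite tauE /tau2 -!scalerAl -!scalerAr.
Qed.

(** On the opposite algebra the left recursion of alpha becomes the right recursion required by the
    abstract argument. *)
Let alpha_c : {linear (Mq q)^c -> GLq q} := alpha.
Let alpha_c_tau : alpha_c (xM q 0 0 + 1 *: xM q 1 1) = 0.
Proof. by rewrite scale1r; apply: alpha_tau. Qed.
Let alpha_c_det : alpha_c (qdet q^-1 (xM q : 'I_2 -> 'I_2 -> (Mq q)^c)) = 0.
Proof. by rewrite (qdet_converse (xM_qmx q)); apply: alpha_det. Qed.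
Let alpha_c_mulx g i j : alpha_c (g * (xM q i j : (Mq q)^c)) = alpha_op i j (alpha_c g).
Proof. exact: alpha_mulx. Qed.
Let alpha1 : prop_to (alpha_c 1) (bal_mono q (0, 0)%N).
Proof. by rewrite [alpha_c 1]alpha_orbit1. Qed.

Let qV : q^-1 != 0. Proof. by rewrite invr_eq0. Qed.

Lemma alpha_nilp_range : range alpha = subalgebra_gen (bal_gens q).
Proof.
rewrite -lin_span_bal.
exact: (nilpotent_orbit_range qV (oner_neq0 K) (is_qmx_converse (xM_qmx q))
  xM_generates_op alpha_c_mulx alpha_opZ alpha_c_tau alpha_c_det alpha1
  alpha_op00 alpha_op01 alpha_op10).
Qed.

(** A right ideal of the opposite algebra is a left ideal of the original one. *)
Lemma alpha_nilp_ker : [set h | alpha h = 0] =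
  [set a * sigma1 q + b * sigma2 q | a in setT & b in setT].
Proof.
have kerP := nilpotent_orbit_ker qV (oner_neq0 K) (is_qmx_converse (xM_qmx q))
  xM_generates_op alpha_c_mulx alpha_opZ alpha_c_tau alpha_c_det alpha1
  alpha_op00 alpha_op01 alpha_op10 (bal_mono_free q0 inj_r).
have {}kerP h : alpha h = 0 <-> exists g g', h = g * sigma1 q + g' * sigma2 q.
  move: (kerP h); rewrite (qdet_converse (xM_qmx q)) scale1r.
  exact.
apply/seteqP; split=> [h /kerP[g [g' ->]]|h [g _ [g' _ <-]]].
  by exists g => //; exists g'.
by apply/kerP; exists g, g'.
Qed.

End NilpotentCase.

Theorem proposition4p1 (R : realType) (q xi1 : R[i]) (q0 : q != 0)
  (xi1_neq0 : xi1 != 0) :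
  let x := xGL q in
  let d := dinv q in
  let B := subalgebra_gen
    [set x 1 0 ^+ 2 * d; x 1 0 * x 1 1 * d; x 1 1 ^+ 2 * d] in
  let beta_xi := beta_orbit q0 (nilp_qmx q xi1) in
  let alpha_xi := alpha_orbit q0 (nilp_qmx q xi1) in
  [/\ range beta_xi = B /\
        is_right_coideal_subalgebra (comulGL q0) (range beta_xi),
      [set h | beta_xi h = 0] = right_ideal_gen [set tau1 q; tau2 q],
      range alpha_xi = B
    & [set h | alpha_xi h = 0] =
        [set a * sigma1 q + b * sigma2 q | a in setT & b in setT]].
Proof.
(* Characteristic 0 supplies the infinitely many parameters for the freeness argument. *)
have inj_r : injective (fun n => n%:R : R[i]).
  by move=> m n /eqP; rewrite Num.Theory.eqr_nat => /eqP.
split; first split.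
- exact: beta_nilp_range.
- by rewrite beta_nilp_range //; apply: bal_gens_coideal.
- exact: beta_nilp_ker inj_r.
- exact: alpha_nilp_range.
- exact: alpha_nilp_ker inj_r.
Qed.
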